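(* Let $0<c<1$ be fixed, let $k\geq 3$ be a fixed integer, and let $n$ be an even integer. Let $g=g(n)\leq c\log_{k-1}(n)$, and let $G$ be a Hamilton cycle on $n$ vertices. Then, with probability tending to $1$ as $n\to\infty$, the $(G,g,k)$-high-girth-process saturates.
   Context: Let $G$ be a graph on vertex set $V$, $|V|=n$, with all degrees at most $k$, and let $g\le n$. The $(G,g,k)$-high-girth-process is the random sequence of graphs $G_0=G, G_1, G_2,\dots$ on $V$ defined as follows. Given $G_t$: if $G_t$ is $k$-regular, set $G_{t+1}=G_t$. Otherwise, let $d<k$ be the minimum degree of $G_t$ and let $W_t$ be the set of vertices of degree $d$ in $G_t$. A pair of distinct vertices $u,v\in W_t$ is available if their distance in $G_t$ is at least $g-1$ (distance is $\infty$ between different components); let $\mathcal{A}_t$ be the set of available pairs. If $\mathcal{A}_t=\emptyset$, set $G_{t+1}=G_t$; otherwise choose $e_{t+1}\in\mathcal{A}_t$ uniformly at random (independently of the past given $G_t$) and let $G_{t+1}$ be $G_t$ with the edge $e_{t+1}$ added. The process saturates if $G_t$ is $k$-regular for some $t$. *)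

(* Defs.v *)
From HB Require Import structures.
From mathcomp Require Import all_boot all_order all_algebra.
From mathcomp Require Import all_classical all_reals all_analysis.

Set Implicit Arguments.
Unset Strict Implicit.
Unset Printing Implicit Defensive.

Import Order.TTheory GRing.Theory Num.Theory.
Import numFieldNormedType.Exports.

(* Finite simple graphs on the vertex set V, given by their sets of edges. *)
Record sgraph (V : finType) : Type := SGraph {
  edges : {set {set V}};
  edgesP : [forall e in edges, #|e| == 2] }.

HB.instance Definition _ (V : finType) := [isSub for @edges V].
HB.instance Definition _ (V : finType) := [Finite of sgraph V by <:].

Section Graphs.
Local Open Scope set_scope.
Local Open Scope nat_scope.
Variable V : finType.
Implicit Types (G : sgraph V) (u v : V) (e : {set V}) (k g m : nat).

Definition adj G : rel V := [rel u v | [set u; v] \in edges G].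

Definition degree G v : nat := #|[pred u | adj G v u]|.

Definition regular k G : bool := [forall v, degree G v == k].

(* All degrees are smaller than #|V|, so the default value #|V| of the
   minimum is immaterial when V is inhabited. *)
Definition min_degree G : nat := \big[minn/#|V|]_(v : V) degree G v.

Definition has_walk G u v m : bool :=
  [exists p : m.-tuple V, path (adj G) u p && (last u p == v)].

(* Length of a shortest walk from u to v, None standing for infinity; two
   vertices in the same component are joined by a walk of length < #|V|. *)
Definition distance G u v : option nat :=
  let m := find (has_walk G u v) (iota 0 #|V|) in
  if m < #|V| then Some m else None.

Definition distance_ge m (x : option nat) : bool :=
  if x is Some l then m <= l else true.

Definition min_degree_vertices G : {set V} :=
  [set v | degree G v == min_degree G].

(* For g = 0 the truncated g.-1 is harmless: any distance is at least 0. *)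
Definition available g G : {set {set V}} :=
  [set e | [exists u, exists v,
    [&& u != v, e == [set u; v],
        u \in min_degree_vertices G, v \in min_degree_vertices G
      & distance_ge g.-1 (distance G u v)]]].

(* The default value G of insubd is only used when e is not a pair of
   distinct vertices. *)
Definition add_edge G e : sgraph V := insubd G (e |: edges G).

Definition hamilton_cycle G : Prop :=
  exists s : seq V, [/\ uniq s, forall v, v \in s, 2 < size s
    & edges G = [set [set v; next s v] | v : V]].

End Graphs.

Section Process.
Local Open Scope classical_set_scope.
Local Open Scope ring_scope.
Variables (R : realType) (V : finType).
Implicit Types (g k : nat) (G H : sgraph V).

(* The conditional probability that G_{t+1} = H given that G_t = G. *)
Definition step_prob g k G H : R :=
  if regular k G || (available g G == finset.set0) then (H == G)%:R
  else #|[pred e in available g G | add_edge G e == H]|%:R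
       / #|available g G|%:R.

(* X is a realization of the (G, g, k)-high-girth-process on the probability
   space (Omega, P): its law is that of the Markov chain started at G with the
   transition probabilities above. *)
Record high_girth_process (d : measure_display) (Omega : measurableType d)
    (P : probability Omega R) g k G (X : nat -> Omega -> sgraph V) : Prop := {
  hgp_measurable : forall t H, measurable [set w | X t w = H];
  hgp_init : P [set w | X 0%N w = G] = 1%E;
  hgp_step : forall t (h : nat -> sgraph V),
    P [set w | forall s, (s <= t.+1)%N -> X s w = h s] =
    (P [set w | forall s, (s <= t)%N -> X s w = h s]
      * (step_prob g k (h t) (h t.+1))%:E)%E }.

Definition saturates k (Omega : Type) (X : nat -> Omega -> sgraph V) :
  set Omega := [set w | exists t, regular k (X t w)].

End Process.

(* Main.v *)
Require Import Defs.
From HB Require Import structures.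
From mathcomp Require Import all_boot all_order all_algebra.
From mathcomp Require Import ring lra zify.
From mathcomp Require Import reals sequences exp.

(** The process runs in stages: stage d turns a d-regular graph H into a
(d+1)-regular one by adding a perfect matching.  Call a vertex unsaturated if
its degree is still d, and let m be the number of unsaturated vertices.

The only danger is that unsaturated vertices become close to each other.  If
all pairs of unsaturated vertices are at distance at least g - 1, then this
stays true after adding an edge, so that the stage is bound to succeed.  Hence
it suffices that no close pair is left when m has dropped to a small power of n.

As long as every unsaturated vertex is close to few others, the added edges
behave like those of a uniform random matching: the probability that
prescribed edges F have been added and that prescribed vertices S are still
unsaturated is at most about n^-|F| (m/n)^|S|; this is a supermartingale
argument.  Following non-backtracking walks and summing over the unknown
endpoints of the new edges, the expected number of r-tuples of unsaturated
vertices close to a given one is at most about (m/n)^(r+1) (k-1)^(gr), where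
(k-1)^g <= n^c.  For large r Markov's inequality shows that, with high
probability, all unsaturated vertices keep being close to few others, and for
r = 1 that no close pair is left at the end. *)

Set Implicit Arguments.
Unset Strict Implicit.
Unset Printing Implicit Defensive.

Import Order.TTheory GRing.Theory Num.Theory.

(** * Graphs and distances *)

Section GraphBasics.
Local Open Scope set_scope.
Local Open Scope nat_scope.
Variable V : finType.
Implicit Types (G H : sgraph V) (u v x y : V) (e : {set V}) (g d : nat).

Lemma set2_eqE x y u v : u != v ->
  ([set x; y] == [set u; v]) = (x == u) && (y == v) || (x == v) && (y == u).
Proof.
move=> uv; apply/eqP/orP => [E|[]/andP[/eqP-> /eqP->] //]; last exact: setUC.
have xy : x != y.
  by have := cards2 u v; rewrite -E cards2 uv; case: (x =P y).
have : x \in [set u; v] by rewrite -E set21.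
have : y \in [set u; v] by rewrite -E set22.
rewrite !inE => /orP[]/eqP ey /orP[]/eqP ex; subst.
- by rewrite eqxx in xy.
- by right; rewrite !eqxx.
- by left; rewrite !eqxx.
- by rewrite eqxx in xy.
Qed.

Lemma card_edge G e : e \in edges G -> #|e| = 2.
Proof. by case: G => E /forall_inP EP /= eE; apply/eqP/EP. Qed.

Lemma adjC G x y : adj G x y = adj G y x.
Proof. by rewrite /adj /= setUC. Qed.

Lemma adj_neq G x y : adj G x y -> x != y.
Proof. by rewrite /adj /= => /card_edge; rewrite cards2; case: (x == y). Qed.

Lemma edges_add G e : #|e| = 2 -> edges (add_edge G e) = e |: edges G.
Proof.
move=> e2; rewrite /add_edge -[edges _]/(val _) insubdK //.
by apply/forall_inP => f; rewrite !inE => /orP[/eqP->|/card_edge->]; rewrite ?e2.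
Qed.

Lemma adj_add G u v x y : u != v ->
  adj (add_edge G [set u; v]) x y = ([set x; y] == [set u; v]) || adj G x y.
Proof.
by move=> uv; rewrite /adj /= edges_add ?cards2 ?uv // in_setU1.
Qed.

Lemma add_edge_id G u v : adj G u v -> add_edge G [set u; v] = G.
Proof.
move=> a; apply: val_inj => /=; rewrite edges_add ?cards2 ?(adj_neq a) //.
by apply/setUidPr; rewrite sub1set.
Qed.

Lemma degree_add G u v x : u != v -> ~~ adj G u v ->
  degree (add_edge G [set u; v]) x = degree G x + (x \in [set u; v]).
Proof.
move=> uv nuv; rewrite /degree; have nvu : ~~ adj G v u by rewrite adjC.
have E y : adj (add_edge G [set u; v]) x y =
    ((x == u) && (y == v) || (x == v) && (y == u)) || adj G x y.
  by rewrite adj_add // set2_eqE.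
rewrite !inE; case: (eqVneq x u) E => [->|xu] /= E.
  rewrite addn1 (cardD1 v) !inE E eqxx add1n; congr _.+1.
  apply: eq_card => y; rewrite !inE E (negPf uv) /= orbF.
  by case: eqVneq => //= ->; rewrite (negPf nuv).
case: (eqVneq x v) E => [->|xv] /= E; last first.
  by rewrite addn0; apply: eq_card => y; rewrite !inE E.
rewrite addn1 (cardD1 u) !inE E eqxx add1n; congr _.+1.
apply: eq_card => y; rewrite !inE E /=.
by case: eqVneq => //= ->; rewrite (negPf nvu).
Qed.

Lemma has_walkP G u v l :
  reflect (exists p, [/\ path (adj G) u p, last u p = v & size p = l])
          (has_walk G u v l).
Proof.
apply: (iffP existsP) => [[p /andP[pP /eqP lP]]|[p [pP lP /eqP sP]]].
  by exists p; rewrite size_tuple.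
by exists (Tuple sP); rewrite /= pP lP eqxx.
Qed.

Definition far g G u v := distance_ge g.-1 (distance G u v).

(** A shortest walk repeats no vertex, so it has fewer than [#|V|] edges; the bounded search in
    [distance] therefore finds it. *)
Lemma farP g G u v :
  reflect (forall p, path (adj G) u p -> last u p = v -> g.-1 <= size p)
          (far g G u v).
Proof.
rewrite /far /distance; set w := has_walk G u v.
have wP l : l < #|V| -> w l -> find w (iota 0 #|V|) <= l.
  move=> ln wl; rewrite leqNgt; apply/negP => lf.
  have := before_find 0 lf.
  by rewrite nth_iota ?add0n ?wl.
have wf : find w (iota 0 #|V|) < #|V| -> w (find w (iota 0 #|V|)).
  move=> fn; have : has w (iota 0 #|V|) by rewrite has_find size_iota.
  by move/(nth_find 0); rewrite nth_iota ?add0n.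
apply: (iffP idP) => [dP p pP lP|].
  have [p' [p'P l'P up' s']] : exists p', [/\ path (adj G) u p', last u p' = v,
      uniq (u :: p') & size p' <= size p].
    case: (shortenP pP) lP => p' p'P up' sub l'P; exists p'; split=> //.
    by apply: uniq_leq_size sub; case/andP: up'.
  have sV : size p' < #|V| by rewrite -[_.+1]/(size (u :: p')) -(card_uniqP up') max_card.
  have fl : find w (iota 0 #|V|) <= size p'.
    by apply: wP => //; apply/has_walkP; exists p'.
  rewrite (leq_ltn_trans fl sV) /= in dP.
  exact: leq_trans dP (leq_trans fl s').
case: ifP => // /wf /has_walkP[p [pP lP sP]] /(_ p pP lP).
by rewrite sP.
Qed.

Lemma farC g G u v : far g G u v = far g G v u.
Proof.
have half a b : far g G a b -> far g G b a.
  move=> /farP f; apply/farP => p pP lP.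
  have := f (rev (belast b p)); rewrite size_rev size_belast; apply.
    by rewrite -lP rev_path; under eq_path do rewrite adjC.
  by case: p lP {pP} => [/=->//|y p /=]; rewrite rev_cons last_rcons.
by apply/idP/idP; exact: half.
Qed.

Lemma far_nadj g G u v : 2 < g -> far g G u v -> ~~ adj G u v.
Proof.
move=> g2 /farP f; apply/negP => uv; have := f [:: v].
by rewrite /= uv => /(_ isT erefl); case: g g2 {f} => [|[|[]]].
Qed.

Lemma path_add_edge G a b x p : a != b ->
  path (adj (add_edge G [set a; b])) x p ->
  exists p', [/\ path (adj G) x p', size p' <= size p
                & last x p' \in [:: last x p; a; b]].
Proof.
move=> ab; elim: p x => [|y p IH] x /=; first by exists [::]; rewrite inE eqxx.
have [xab|xab] := boolP (x \in [:: a; b]).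
  by exists [::]; rewrite /= inE xab orbT.
rewrite adj_add // set2_eqE //; move: xab; rewrite !inE.
case/norP=> /negPf-> /negPf-> /= /andP[xy /IH[p' [p'P s' l']]].
by exists (y :: p'); rewrite /= xy.
Qed.

Lemma far_add_edge g G a b u v : a != b ->
  far g G u a -> far g G u b -> far g G u v ->
  far g (add_edge G [set a; b]) u v.
Proof.
move=> ab /farP fa /farP fb /farP fv; apply/farP => p pP lP.
have [p' [p'P s' l']] := path_add_edge ab pP.
apply: leq_trans s'; move: l'; rewrite lP !inE => /or3P[]/eqP l'.
- exact: fv.
- exact: fa.
- exact: fb.
Qed.

End GraphBasics.

(** * Graphs arising within one stage *)

Section StageGraphs.
Local Open Scope set_scope.
Local Open Scope nat_scope.
Variables (V : finType) (H : sgraph V) (d g : nat).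
Implicit Types (G : sgraph V) (u v x y : V) (e : {set V}).

Definition unsat G := [set v | degree G v == d].

(** Pairs are ordered, which turns sums over them into double sums; each edge of [available] is
    counted twice, so averages are unaffected. *)
Definition avail_pairs G : {set V * V} :=
  [set e | [&& e.1 != e.2, e.1 \in unsat G, e.2 \in unsat G
            & far g G e.1 e.2]].

Definition close G u := [set v in unsat G | (v != u) && ~~ far g G u v].

(** The invariant of a stage: when [H] is [d]-regular, the edges of such a [G] outside [H] form a
    matching. *)
Definition stage_graph G :=
  (edges H \subset edges G) && [forall v, degree G v <= d.+1].

Lemma in_close G u v :
  (v \in close G u) = [&& v \in unsat G, v != u & ~~ far g G u v].
Proof. by rewrite inE. Qed.

Hypothesis Hreg : regular d H.

Lemma degree_start v : degree H v = d.
Proof. exact/eqP/(forallP Hreg). Qed.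

Lemma unsat_start : unsat H = [set: V].
Proof. by apply/setP => v; rewrite !inE degree_start eqxx. Qed.

Lemma stage_start : stage_graph H.
Proof. by rewrite /stage_graph subxx; apply/forallP => v; rewrite degree_start. Qed.

Lemma stage_adj G x y : stage_graph G -> adj H x y -> adj G x y.
Proof. by case/andP=> /subsetP HG _; exact: HG. Qed.

Lemma stage_degree_ge G v : stage_graph G -> d <= degree G v.
Proof.
move=> GP; rewrite -(degree_start v); apply/subset_leq_card/subsetP => u.
by rewrite !inE; exact: stage_adj.
Qed.

Lemma stage_new_unsat G x y :
  stage_graph G -> adj G x y -> ~~ adj H x y -> x \notin unsat G.
Proof.
move=> GP xy nxy; rewrite inE; apply/eqP => dx.
have: degree H x < degree G x.
  apply/proper_card/properP; split; last by exists y; rewrite !inE.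
  by apply/subsetP => u; rewrite !inE; exact: stage_adj.
by rewrite degree_start dx ltnn.
Qed.

Lemma stage_new_inj G x y z : stage_graph G ->
  adj G x y -> ~~ adj H x y -> adj G x z -> ~~ adj H x z -> y = z.
Proof.
move=> GP xy nxy xz nxz; apply/eqP; apply: contraT => yz.
case/andP: (GP) => _ /forallP/(_ x).
suff : d.+2 <= degree G x by move=> h /(leq_trans h); rewrite ltnn.
rewrite /degree (cardD1 y) (cardD1 z) !inE xy xz eq_sym yz /= !add1n !ltnS.
rewrite -(degree_start x); apply/subset_leq_card/subsetP => u; rewrite !inE => xu.
rewrite (stage_adj GP xu) andbT; apply/andP; split; apply: contraTneq xu => ->.
- by rewrite nxz.
- by rewrite nxy.
Qed.

Lemma stage_regular G : stage_graph G -> unsat G = set0 -> regular d.+1 G.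
Proof.
move=> GP W0; apply/forallP => v; case/andP: (GP) => _ /forallP/(_ v) vd.
have := in_set0 v; rewrite -W0 inE => /negbT vn.
by rewrite eqn_leq vd ltn_neqAle eq_sym vn stage_degree_ge.
Qed.

Hypothesis g3 : 2 < g.

Lemma avail_pairsC G u v : ((u, v) \in avail_pairs G) = ((v, u) \in avail_pairs G).
Proof. by rewrite !inE /= eq_sym farC; congr andb; rewrite !andbA [X in X && _]andbC. Qed.

Lemma avail_pairs_unsat G u v : (u, v) \in avail_pairs G ->
  [/\ u != v, u \in unsat G, v \in unsat G & ~~ adj G u v].
Proof. by rewrite inE => /and4P[-> -> -> /(far_nadj g3)]. Qed.

Lemma unsat_add G u v : (u, v) \in avail_pairs G -> stage_graph G ->
  unsat (add_edge G [set u; v]) = unsat G :\: [set u; v].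
Proof.
move=> /avail_pairs_unsat[uv uW vW nuv] GP; apply/setP => x.
rewrite !inE degree_add // !inE; case: (boolP ((x == u) || _)) => //= xuv; last first.
  by rewrite addn0.
by rewrite addn1; apply/negbTE; rewrite gtn_eqF // ltnS stage_degree_ge.
Qed.

Lemma card_unsat_add G u v : (u, v) \in avail_pairs G -> stage_graph G ->
  #|unsat G| = (#|unsat (add_edge G [set u; v])|).+2.
Proof.
move=> uvA GP; have [uv uW vW nuv] := avail_pairs_unsat uvA.
rewrite unsat_add // -(cardsID [set u; v] (unsat G)) (setIidPr _) ?cards2 ?uv //.
by apply/subsetP => x /set2P[]->.
Qed.

Lemma stage_add G u v : (u, v) \in avail_pairs G -> stage_graph G ->
  stage_graph (add_edge G [set u; v]).
Proof.
move=> /avail_pairs_unsat[uv uW vW nuv] /andP[HG /forallP dG].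
apply/andP; split.
  rewrite edges_add ?cards2 ?uv //; apply: subset_trans HG _.
  exact: subsetUr.
apply/forallP => x; rewrite degree_add //.
have [/set2P[]->|_] := boolP (x \in _); rewrite ?addn0 ?addn1 ?dG //.
  by move: uW; rewrite inE => /eqP->.
by move: vW; rewrite inE => /eqP->.
Qed.

Lemma card_avail_pairs_le G : #|avail_pairs G| <= #|unsat G| ^ 2.
Proof.
rewrite -mulnn -cardsX; apply/subset_leq_card/subsetP => -[u v].
by rewrite !inE /= => /and4P[_ -> -> _].
Qed.

(** Between distinct unsaturated vertices, closeness is the only obstacle to availability; the 1
    counts [x] itself. *)
Lemma card_avail_of G x : x \in unsat G ->
  #|[set v | (x, v) \in avail_pairs G]| + #|close G x| + 1 = #|unsat G|.
Proof.
move=> xW; rewrite -(cardsID (close G x) (unsat G)) (setIidPr _); last first.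
  by apply/subsetP => v; rewrite inE => /andP[].
rewrite addnAC addnC; congr addn; rewrite (cardsD1 x (_ :\: _)).
move: xW; rewrite !inE => xW; rewrite eqxx xW /= addnC; congr addn.
apply: eq_card => v; rewrite !inE xW /= eq_sym.
by case: (v == x) => //=; case: (degree G v == d) => //=; rewrite negbK andbT.
Qed.

End StageGraphs.

(** * Double counting of pairs of vertices *)

Section PairCounting.
Local Open Scope set_scope.
Local Open Scope nat_scope.
Variable V : finType.

Lemma card2_ordered (e : {set V}) : #|e| = 2 ->
  #|[set x : V * V | [set x.1; x.2] == e]| = 2.
Proof.
case/eqP/cards2P=> a [b [ab ->]].
have -> : [set x : V * V | [set x.1; x.2] == [set a; b]] = [set (a, b); (b, a)].
  by apply/setP => -[x y]; rewrite !inE /= set2_eqE // -!pair_eqE.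
by rewrite cards2 -pair_eqE /pair_eq /= (negPf ab).
Qed.

Lemma card_ordered (P : {set {set V}}) : (forall e, e \in P -> #|e| = 2) ->
  #|[set x : V * V | [set x.1; x.2] \in P]| = 2 * #|P|.
Proof.
move=> P2; rewrite -sum1dep_card.
rewrite (partition_big (fun x : V * V => [set x.1; x.2]) (mem P)) //=.
rewrite mulnC -sum_nat_const; apply: eq_bigr => e eP.
rewrite -[RHS](card2_ordered (P2 e eP)) -sum1dep_card; apply: eq_bigl => x.
by apply: andb_idl => /eqP->.
Qed.

(** Inclusion-exclusion for the pairs whose first, respectively second, component lies in [T]: by
    symmetry both sets have the same size, and their overlap consists of pairs from [T]. *)
Lemma card_avoid_pairs (A : {set V * V}) (T : {set V}) :
  (forall u v, ((u, v) \in A) = ((v, u) \in A)) ->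
  #|[set x in A | (x.1 \notin T) && (x.2 \notin T)]|
    + 2 * \sum_(x in T) #|[set v | (x, v) \in A]| <= #|A| + #|T| ^ 2.
Proof.
move=> AC.
pose A1 := [set x in A | x.1 \in T]; pose A2 := [set x in A | x.2 \in T].
have cA1 : #|A1| = \sum_(x in T) #|[set v | (x, v) \in A]|.
  rewrite -sum1dep_card; under [RHS]eq_bigr do rewrite -sum1dep_card.
  rewrite pair_big_dep /=; apply: eq_bigl => -[u v] /=.
  by rewrite andbC.
have cA2 : #|A2| = #|A1|.
  have sI : injective (fun x : V * V => (x.2, x.1)) by move=> [? ?] [? ?] [-> ->].
  rewrite -(card_imset (mem A1) sI); apply: eq_card => -[u v].
  apply/idP/imsetP => [|[[x y]]]; rewrite !inE /=.
    by move=> uv; exists (v, u); rewrite // !inE /= AC.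
  by rewrite AC => ? [-> ->].
have -> : [set x in A | (x.1 \notin T) && (x.2 \notin T)] = A :\: (A1 :|: A2).
  apply/setP => -[u v]; rewrite !inE /=; case: ((u, v) \in A) => //=.
  by rewrite negb_or andbT.
have c12 : #|A1 :&: A2| <= #|T| ^ 2.
  rewrite -mulnn -cardsX; apply/subset_leq_card/subsetP => -[u v].
  by rewrite !inE /= => /andP[/andP[_ ->] /andP[_ ->]].
rewrite -cA1 mul2n -addnn -{2}cA2 -cardsUI addnA.
rewrite -(cardsID (A1 :|: A2) A) [X in _ <= X + _]addnC [A :&: _](setIidPr _).
  by rewrite leq_add2l.
by apply/subsetP => x; rewrite !inE => /orP[]/andP[].
Qed.

End PairCounting.

(** * The numerical inequality behind the supermartingale *)

Section PotentialIneq.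
Local Open Scope set_scope.
Local Open Scope nat_scope.
Local Open Scope ring_scope.
Variable R : realFieldType.

Lemma bernoulli_le (x : R) p : 0 <= x <= 1 -> 1 - p%:R * x <= (1 - x) ^+ p.
Proof.
move=> /andP[x0 x1]; elim: p => [|p IH]; first by rewrite expr0 mul0r subr0.
rewrite exprS; have h : (1 - x) * (1 - p%:R * x) <= (1 - x) * (1 - x) ^+ p.
  by apply: ler_wpM2l IH; rewrite subr_ge0.
apply: le_trans h; rewrite -natr1; have : 0 <= p%:R * x * x by rewrite !mulr_ge0.
lra.
Qed.

(** In one step [m.+2] unsaturated vertices become [m]; [N] counts the ordered available pairs, and
    [2 * j + s] vertices are reserved, by [j] pending edges and [s] prescribed vertices. The
    numerator combines the pairs that complete a pending edge with those that avoid all reserved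
    vertices. By Bernoulli's inequality the change of denominator costs a factor of about
    [1 - 2 * (j + s) / m.+2]; the leading terms cancel and [theta] absorbs the rest. *)
Lemma potential_ineq (m j s : nat) (N eta theta : R) :
  0 < theta <= 1 -> 0 <= eta -> 0 <= N <= m.+2%:R ^+ 2 ->
  4 * (2 * j + s)%N%:R * (1 + eta * m.+2%:R) + 2 * (2 * j + s)%N%:R ^+ 2
    <= theta * m.+2%:R ->
  (4 * (2 * j + s) <= m.+2)%N ->
  (2 * j%:R * m%:R + N
     - 2 * (2 * j + s)%N%:R * (m.+2%:R - 1 - eta * m.+2%:R)
     + (2 * j + s)%N%:R ^+ 2) / m%:R ^+ (j + s)
  <= N * (1 + theta / m.+2%:R) / m.+2%:R ^+ (j + s).
Proof.
move=> /andP[t0 t1] e0 /andP[N0 Nm] hq q4.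
have x0 : 0 < m.+2%:R :> R by [].
(* The case without reserved vertices stays apart because [m] may be 0 in it. *)
case: (posnP (j + s)) => [/eqP|p0].
  rewrite addn_eq0 => /andP[/eqP-> /eqP->].
  rewrite muln0 addn0 expr0 !divr1 !mulr0 !mul0r add0r subr0 expr0n /= addr0.
  by rewrite ler_peMr // lerDl divr_ge0 // ltW.
have m0 : (0 < m)%N by lia.
have M0 : 0 < m%:R :> R by rewrite ltr0n.
set x := m.+2%:R in hq x0 Nm *; set q := (2 * j + s)%N%:R in hq *.
have mx : m%:R = x - 2 by rewrite /x -addn2 natrD addrK.
set Z := (X in X / _ <= _).
have -> : m%:R = x * (1 - 2 / x) by rewrite mx mulrBr mulr1 mulrC divfK // gt_eqF.
rewrite exprMn [x ^+ _ * _]mulrC invfM mulrA ler_pM2r ?invr_gt0 ?exprn_gt0 //.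
rewrite /Z mx {Z}.
have r0 : 0 < 1 - 2 / x by rewrite subr_gt0 ltr_pdivrMr // mul1r /x ltr_nat.
rewrite ler_pdivrMr ?exprn_gt0 //.
have xV : x * x^-1 = 1 by rewrite mulfV // gt_eqF.
have xi0 : 0 < x^-1 by rewrite invr_gt0.
have B := @bernoulli_le (2 / x) (j + s) .
have /B {}B : 0 <= 2 / x <= 1 by rewrite divr_ge0 ?(ltW x0) //= ler_pdivrMr // mul1r ler_nat.
have h1 : 0 <= N * (1 + theta / x).
  by rewrite mulr_ge0 // addr_ge0 // divr_ge0 // ltW.
apply: le_trans (ler_wpM2l h1 B).
set p := (j + s)%N%:R.
have pq : q = j%:R + p by rewrite /q /p natrD natrM natrD; ring.
have p1 : 1 <= p by rewrite ler1n.
have p4 : 4 * p <= x by rewrite /p /x -natrM ler_nat; lia.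
have j0 : 0 <= j%:R :> R by [].
pose i := x^-1; rewrite -!/i in xV xi0 *.
have pi : p * i <= 4^-1.
  by have := ler_wpM2r (ltW xi0) p4; rewrite xV -mulrA => h; lra.
have a1 : N * (1 + theta * i) * (1 - p * (2 * i)) >= N * (1 - 2 * p * i + theta * i / 2).
  rewrite -[X in _ <= X]mulrA; apply: ler_wpM2l => //.
  have : theta * i * (2 * (p * i)) <= theta * i * (2 * 4^-1).
    apply: ler_wpM2l; first by rewrite mulr_ge0 // ltW.
    by apply: ler_wpM2l.
  by move=> h; lra.
apply: le_trans a1.
(* [N <= x ^+ 2] makes the loss linear in [x], to be compared with the pairs that hit reserved
   vertices. *)
have a2 : N * ((2 * p - theta / 2) * i) <= x * (2 * p - theta / 2).
  have pp : 0 <= 2 * p - theta / 2 by lra.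
  have := ler_wpM2r (mulr_ge0 pp (ltW xi0)) Nm.
  by rewrite expr2 -[X in _ <= X]mulrA [x * (_ * i)]mulrCA xV mulr1.
have h3 : N * (1 - 2 * p * i + theta * i / 2) = N - N * ((2 * p - theta / 2) * i).
  by ring.
rewrite h3; apply: (@le_trans _ _ (N - x * (2 * p - theta / 2))); last first.
  by rewrite lerD2l lerN2.
have -> : 2 * j%:R * (x - 2) + N - 2 * q * (x - 1 - eta * x) + q ^+ 2 =
   N - 2 * p * x - 4 * j%:R + (4 * q * (1 + eta * x) + 2 * q ^+ 2) / 2.
  by rewrite pq; field.
lra.
Qed.

End PotentialIneq.

(** * The random matching added in one stage *)

Section GoodProcess.
Local Open Scope set_scope.
Local Open Scope nat_scope.
Local Open Scope ring_scope.
Variables (R : realFieldType) (V : finType) (H : sgraph V) (d g : nat).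
Hypotheses (Hreg : regular d H) (g3 : (2 < g)%N).
Variables (eta : R).
Implicit Types (G : sgraph V) (u v x y : V) (F : {set {set V}}) (S : {set V}).

Local Notation unsat := (unsat d).
Local Notation avail_pairs := (avail_pairs d g).
Local Notation close := (close d g).
Local Notation stage_graph := (stage_graph H d).

Definition good G :=
  [forall u in unsat G, #|close G u|%:R <= eta * #|unsat G|%:R].

(* The law at time t of the process killed on leaving the good states. *)
Fixpoint mu t : sgraph V -> R :=
  if t is t'.+1 then fun G' =>
    \sum_G mu t' G * ((good G)%:R / #|avail_pairs G|%:R
      * \sum_(e in avail_pairs G) (add_edge G [set e.1; e.2] == G')%:R)
  else fun G => (G == H)%:R.

Lemma mu_ge0 t G : 0 <= mu t G.
Proof.
elim: t G => [|t IH] G /=; first exact: ler0n.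
apply: sumr_ge0 => G1 _; rewrite !mulr_ge0 ?invr_ge0 //.
by apply: sumr_ge0.
Qed.

Lemma sum_mu0 (f : sgraph V -> R) : \sum_G mu 0 G * f G = f H.
Proof.
rewrite (bigD1 H) //= eqxx mul1r big1 ?addr0 // => G /negPf->.
by rewrite mul0r.
Qed.

Lemma sum_muS t (f : sgraph V -> R) : \sum_G mu t.+1 G * f G =
  \sum_G mu t G * ((good G)%:R / #|avail_pairs G|%:R
      * \sum_(e in avail_pairs G) f (add_edge G [set e.1; e.2])).
Proof.
under eq_bigr do rewrite /= mulr_suml.
rewrite exchange_big /=; apply: eq_bigr => G _.
under eq_bigr do rewrite -!mulrA.
rewrite -!mulr_sumr -!mulrA; do 3!congr (_ * _).
under [LHS]eq_bigr do rewrite mulr_suml.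
rewrite exchange_big /=; apply: eq_bigr => e _.
rewrite (bigD1 (add_edge G [set e.1; e.2])) //= eqxx mul1r big1 ?addr0 // => G'.
by rewrite eq_sym => /negPf->; rewrite mul0r.
Qed.

Lemma mu_supp t G : mu t G != 0 ->
  stage_graph G /\ (#|unsat G| + 2 * t = #|V|)%N.
Proof.
elim: t G => [|t IH] G /=.
  rewrite pnatr_eq0 eqb0 negbK => /eqP->; split; first exact: stage_start.
  by rewrite unsat_start // cardsT muln0 addn0.
move=> h; have [G1 hG1] : exists G1, mu t G1 * ((good G1)%:R / #|avail_pairs G1|%:R
      * \sum_(e in avail_pairs G1) (add_edge G1 [set e.1; e.2] == G)%:R) != 0.
  apply/existsP; apply: contraNT h; rewrite negb_exists => /forallP h.
  by rewrite big1 // => G1 _; move/negPn/eqP: (h G1).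
have /IH[sG1 cG1] : mu t G1 != 0 by apply: contraNneq hG1 => ->; rewrite mul0r.
have [[u v] uvA /eqP<-] : exists2 e, e \in avail_pairs G1 & add_edge G1 [set e.1; e.2] == G.
  apply/exists_inP; apply: contraNT hG1; rewrite negb_exists_in => /forall_inP h1.
  by rewrite [X in _ * (_ * X)]big1 ?mulr0 // => e /h1/negPf->.
rewrite (stage_add g3 uvA) //; split=> //=.
rewrite -cG1 (card_unsat_add Hreg g3 uvA) //; lia.
Qed.

Lemma le_sum_mu t (f f' : sgraph V -> R) :
  (forall G, stage_graph G -> (#|unsat G| + 2 * t = #|V|)%N -> f G <= f' G) ->
  \sum_G mu t G * f G <= \sum_G mu t G * f' G.
Proof.
move=> ff; apply: ler_sum => G _; have [->|/mu_supp[sG cG]] := eqVneq (mu t G) 0.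
  by rewrite !mul0r.
by apply: ler_wpM2l (ff _ sG cG); exact: mu_ge0.
Qed.

(** A supermartingale has nonincreasing expectation. Killing only removes mass, which is harmless
    because [f] is nonnegative. *)
Lemma sum_mu_super t0 (f : sgraph V -> R) : (forall G, 0 <= f G) ->
  (forall t G, (t < t0)%N -> stage_graph G -> (#|unsat G| + 2 * t = #|V|)%N ->
     good G ->
     \sum_(e in avail_pairs G) f (add_edge G [set e.1; e.2])
       <= #|avail_pairs G|%:R * f G) ->
  \sum_G mu t0 G * f G <= f H.
Proof.
move=> f0 hf; elim: t0 hf => [|t IH] hf; first by rewrite sum_mu0.
have := IH (fun s G st => hf s G (ltnW st)); apply: le_trans.
rewrite sum_muS; apply: le_sum_mu => G sG cG.
case: (boolP (good G)) => gG; last by rewrite !mul0r f0.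
rewrite mul1r mulrC; have [->|A0] := posnP #|avail_pairs G|.
  by rewrite invr0 mulr0 f0.
by rewrite ler_pdivrMr ?ltr0n // mulrC; exact: (hf t).
Qed.

(** [q0] bounds the number of reserved vertices, and the estimates hold while at least [M] vertices
    are unsaturated. [lam m] will be the power [theta] of [m]. *)
Variables (theta : R) (q0 M : nat) (lam : nat -> R).
Hypotheses (t01 : 0 < theta <= 1) (e0 : 0 <= eta).
Hypothesis (cond1 : forall m, (M <= m)%N ->
  4 * q0%:R * (1 + eta * m%:R) + 2 * q0%:R ^+ 2 <= theta * m%:R).
Hypothesis (cond2 : (4 * q0 <= M)%N).
Hypothesis lam_ge1 : forall m, (0 < m)%N -> 1 <= lam m.
Hypothesis lam_ge0 : forall m, 0 <= lam m.
Hypothesis lamSS : forall m, lam m * (1 + theta / m.+2%:R) <= lam m.+2.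

(* F stands for prescribed new edges, S for vertices that have to remain
   unsaturated. *)
Definition new_matching F S := [&& trivIset F,
  [forall e in F, (#|e| == 2) && (e \notin edges H)] & [disjoint S & cover F]].

Definition pending F G := F :\: edges G.

Definition compatible F S G :=
  (S \subset unsat G) && [forall e in pending F G, e \subset unsat G].

(* In a uniform random matching of the m unsaturated vertices, a given pending
   edge is eventually chosen with probability about 1/m, and a given vertex is
   among the last m' unsaturated ones with probability m'/m; lam absorbs the
   error terms. *)
Definition potential F S G : R := (compatible F S G)%:R
  * (lam #|unsat G| / #|unsat G|%:R ^+ (#|pending F G| + #|S|)).

Lemma potential_ge0 F S G : 0 <= potential F S G.
Proof. by rewrite /potential mulr_ge0 // divr_ge0 ?lam_ge0 ?exprn_ge0. Qed.

(** The constraints survive the edge [uv] in two ways only: both ends avoid the reserved set [T], or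
    [uv] is itself pending and the exponent drops by one. *)
Lemma potential_add F S G u v m T : new_matching F S -> stage_graph G ->
  (u, v) \in avail_pairs G -> m = #|unsat (add_edge G [set u; v])| ->
  T = S :|: cover (pending F G) ->
  potential F S (add_edge G [set u; v]) <= (compatible F S G)%:R *
   (lam m * (((u \notin T) && (v \notin T))%:R / m%:R ^+ (#|pending F G| + #|S|)
    + ([set u; v] \in pending F G)%:R / m%:R ^+ (#|pending F G| + #|S|).-1)).
Proof.
move=> nF sG uvA mE TE; have [uv uW vW nuv] := avail_pairs_unsat g3 uvA.
set G' := add_edge _ _ in mE *.
have m0 p : 0 <= m%:R ^- p :> R by rewrite invr_ge0 exprn_ge0.
have R0 : 0 <= lam m * (((u \notin T) && (v \notin T))%:R / m%:R ^+ (#|pending F G| + #|S|)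
    + ([set u; v] \in pending F G)%:R / m%:R ^+ (#|pending F G| + #|S|).-1).
  by rewrite mulr_ge0 ?lam_ge0 // addr_ge0 // mulr_ge0.
rewrite {1}/potential -mE; case: (boolP (compatible F S G')); last first.
  by rewrite mul0r => _; rewrite mulr_ge0.
rewrite mul1r; case/andP; rewrite (unsat_add Hreg g3 uvA sG) => SW /forall_inP pW.
have pE : pending F G' = pending F G :\ [set u; v].
  apply/setP => e; rewrite !inE edges_add ?cards2 ?uv // !inE negb_or.
  by rewrite andbA.
have cG : compatible F S G.
  apply/andP; split; first exact: subset_trans SW (subsetDl _ _).
  apply/forall_inP => e ep; have [->|ne] := eqVneq e [set u; v].
    by apply/subsetP => z /set2P[]->.
  by apply: subset_trans (pW e _) (subsetDl _ _); rewrite pE in_setD1 ne.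
rewrite cG mul1r ler_wpM2l ?lam_ge0 // pE.
have := cardsD1 [set u; v] (pending F G).
case: (boolP ([set u; v] \in pending F G)) => [uvp|uvp] /= cp.
  rewrite [in X in _ <= _ + X]cp add1n addSn /= mul1r lerDr.
  by rewrite mulr_ge0.
rewrite add0n in cp; rewrite -cp mul0r addr0.
suff -> : (u \notin T) && (v \notin T) by rewrite mul1r.
have hz z : z \in [set u; v] -> z \notin T.
  move=> zuv; rewrite TE inE negb_or; apply/andP; split.
    by apply/negP => /(subsetP SW); rewrite inE zuv.
  apply/negP => /bigcupP[e ep ze].
  have : e \in pending F G' by rewrite pE in_setD1 ep andbT; apply: contraNneq uvp => <-.
  by move/pW/subsetP/(_ z ze); rewrite inE zuv.
by rewrite !hz ?set21 ?set22.
Qed.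

Lemma card_protected F S G : new_matching F S ->
  #|S :|: cover (pending F G)| = (2 * #|pending F G| + #|S|)%N.
Proof.
case/and3P=> tF /forall_inP F2 dS.
have sp : pending F G \subset F by exact: subsetDl.
have tp : trivIset (pending F G) by apply/trivIsetS: tF.
have c0 : cover (pending F G) \subset cover F.
  by apply/bigcupsP => e ep; apply: (bigcup_sup e) => //; exact: subsetP sp _ ep.
have -> : #|S :|: cover (pending F G)| = (#|S| + #|cover (pending F G)|)%N.
  apply/eqP; rewrite (leq_card_setU S (cover (pending F G))).2.
  exact: disjointWr c0 dS.
rewrite addnC -(eqP tp); congr addn; rewrite mulnC -sum_nat_const.
by apply: eq_bigr => e /(subsetP sp)/F2/andP[/eqP].
Qed.

(** Sum [potential_add] over the available pairs. Goodness gives every reserved vertex many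
    available partners, so by [card_avoid_pairs] enough pairs hit [T]; a pending edge arises from at
    most two ordered pairs. [potential_ineq] and the growth of [lam] then conclude. *)
Lemma potential_super F S G : new_matching F S -> (2 * #|F| + #|S| <= q0)%N ->
  stage_graph G -> good G -> (M <= #|unsat G|)%N ->
  \sum_(e in avail_pairs G) potential F S (add_edge G [set e.1; e.2])
    <= #|avail_pairs G|%:R * potential F S G.
Proof.
move=> nF FS sG gG MG.
have [A0|A0] := posnP #|avail_pairs G|.
  rewrite big1 ?A0 ?mul0r // => e eA.
  by have := card0_eq A0 e; rewrite eA.
set j := #|pending F G|; set s := #|S|.
have jF : (j <= #|F|)%N by apply/subset_leq_card/subsetDl.
have [[u0 v0] uv0] : exists e, e \in avail_pairs G by apply/set0Pn; rewrite -card_gt0.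
have := card_unsat_add Hreg g3 uv0 sG; set m := #|unsat (add_edge _ _)| => cm.
have me e : e \in avail_pairs G -> #|unsat (add_edge G [set e.1; e.2])| = m.
  case: e => u v uvA; have := card_unsat_add Hreg g3 uvA sG.
  by rewrite cm => -[].
set T := S :|: cover (pending F G).
have [cG|cG] := boolP (compatible F S G); last first.
  rewrite /potential (negPf cG) mul0r mulr0 big1 // => -[u v] uvA.
  apply/eqP; rewrite -/(potential F S _) eq_le potential_ge0 andbT.
  by have := potential_add nF sG uvA erefl erefl; rewrite (negPf cG) mul0r.
have pbound : \sum_(e in avail_pairs G) potential F S (add_edge G [set e.1; e.2])
   <= lam m * (#|[set x in avail_pairs G | (x.1 \notin T) && (x.2 \notin T)]|%:R / m%:R ^+ (j + s)
        + (2 * j)%:R / m%:R ^+ (j + s).-1).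
  have h e : e \in avail_pairs G -> potential F S (add_edge G [set e.1; e.2]) <=
    lam m * (((e.1 \notin T) && (e.2 \notin T))%:R / m%:R ^+ (j + s)
     + ([set e.1; e.2] \in pending F G)%:R / m%:R ^+ (j + s).-1).
    case: e => u v uvA.
    by have := potential_add nF sG uvA (esym (me _ uvA)) erefl; rewrite cG mul1r.
  apply: le_trans (ler_sum _ h) _; rewrite -mulr_sumr ler_wpM2l ?lam_ge0 //.
  rewrite big_split /= -!mulr_suml -!natr_sum; apply: lerD.
    rewrite ler_wpM2r ?invr_ge0 ?exprn_ge0 // ler_nat.
    by rewrite -sum1dep_card big_mkcondr.
  rewrite ler_wpM2r ?invr_ge0 ?exprn_ge0 // ler_nat.
  rewrite /j -card_ordered; last first.
    move=> e; rewrite inE => /andP[_ eF]; case/and3P: nF => _ /forall_inP/(_ e eF).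
    by case/andP=> /eqP.
  rewrite -sum1dep_card [leqRHS]big_mkcond /= big_mkcond /=; apply: leq_sum => e _.
  by case: ifP => // _; case: ifP.
apply: le_trans pbound _.
have TW : T \subset unsat G.
  case/andP: cG => SW /forall_inP pW; rewrite subUset SW.
  by apply/bigcupsP => e; exact: pW.
have cT := card_protected G nF; rewrite -/T -/j -/s in cT.
have avo := @card_avoid_pairs V (avail_pairs G) T (avail_pairsC d g G).
set fr := #|[set _ in _ | _ ]| in avo *.
have sumav : ((2 * j + s)%N%:R * (m.+2%:R - 1 - eta * m.+2%:R) <=
     (\sum_(x in T) #|[set v | (x, v) \in avail_pairs G]|)%N%:R :> R).
  rewrite natr_sum -cT -[X in X * _]mulr_natr mul1r mulr_natl -sumr_const.
  apply: ler_sum => x xT; have xW := subsetP TW x xT.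
  have := forall_inP gG x xW; have := card_avail_of g xW.
  by rewrite cm => /(congr1 (fun n => n%:R : R)); rewrite !natrD; lra.
have q0b : (2 * j + s <= q0)%N by apply: leq_trans FS; rewrite leq_add2r leq_mul2l jF orbT.
have q0b' : (2 * j + s)%N%:R <= q0%:R :> R by rewrite ler_nat.
have N0 : 0 <= (#|avail_pairs G|%:R : R) <= m.+2%:R ^+ 2.
  by rewrite ler0n -natrX ler_nat -cm card_avail_pairs_le.
have c1 : 4 * (2 * j + s)%N%:R * (1 + eta * m.+2%:R) + 2 * (2 * j + s)%N%:R ^+ 2
    <= theta * m.+2%:R.
  have em : 0 <= 1 + eta * m.+2%:R by rewrite addr_ge0 // mulr_ge0.
  have := cond1 MG; rewrite cm; apply: le_trans; apply: lerD.
    by rewrite ler_wpM2r // ler_wpM2l.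
  by rewrite ler_wpM2l // lerXn2r // nnegrE.
have c2 : (4 * (2 * j + s) <= m.+2)%N 
  by rewrite -cm; apply: leq_trans MG; apply: leq_trans cond2; rewrite leq_mul2l.
have ineq := potential_ineq t01 e0 N0 c1 c2.
rewrite /potential cG mul1r cm -/j -/s.
have L0 : 0 <= lam m by exact: lam_ge0.
apply: (@le_trans _ _ (lam m * (#|avail_pairs G|%:R * (1 + theta / m.+2%:R) / m.+2%:R ^+ (j + s)))).
  rewrite ler_wpM2l //; apply: le_trans ineq.
  (* For [j + s = 0] the truncated predecessor is harmless, since then [j = 0] and both sides
     vanish. *)
  have -> : (2 * j)%:R / m%:R ^+ (j + s).-1 = 2 * j%:R * m%:R / m%:R ^+ (j + s) :> R.
    rewrite natrM; have [p0|p0] := posnP (j + s).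
      move/eqP: (p0); rewrite addn_eq0 => /andP[/eqP-> _].
      by rewrite !mulr0 !mul0r.
    rewrite -{2}(prednK p0) exprS invfM mulrA; congr (_ / _).
    rewrite mulfK // pnatr_eq0 -lt0n -2!ltnS.
    apply: leq_trans c2; apply: (@leq_trans 4) => //; rewrite leq_pmulr //.
    by apply: leq_trans p0 _; rewrite leq_add2r leq_pmull.
  rewrite -mulrDl ler_wpM2r ?invr_ge0 ?exprn_ge0 //.
  move: avo; rewrite -(ler_nat R) natrD natrM [X in _ <= X]natrD natrX cT.
  move: sumav; lra.
have X0 : 0 <= #|avail_pairs G|%:R / m.+2%:R ^+ (j + s) :> R.
  by rewrite divr_ge0 // exprn_ge0.
have := ler_wpM2r X0 (lamSS m); congr (_ <= _); ring.
Qed.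

(** At the start all of [F] is pending, and the potential of [H] is the bound up to the factor
    [m ^+ #|S|], where [m] vertices are unsaturated at time [t]. On the event nothing is pending at
    time [t], and the potential is at least [m ^- #|S|] because [lam m >= 1]. *)
Lemma sum_mu_event F S t : new_matching F S -> (2 * #|F| + #|S| <= q0)%N ->
  (0 < M)%N -> (2 * t + M <= #|V|)%N ->
  \sum_G mu t G * ((F \subset edges G) && (S \subset unsat G))%:R
    <= lam #|V| * ((#|V| - 2 * t)%N%:R / #|V|%:R) ^+ #|S| / #|V|%:R ^+ #|F|.
Proof.
move=> nF FS M0 tM; have := @sum_mu_super t (potential F S) (potential_ge0 F S).
have hs s G : (s < t)%N -> stage_graph G -> (#|unsat G| + 2 * s = #|V|)%N ->
    good G -> \sum_(e in avail_pairs G) potential F S (add_edge G [set e.1; e.2])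
       <= #|avail_pairs G|%:R * potential F S G.
  by move=> st sG cG gG; apply: potential_super => //; lia.
move=> /(_ hs) {hs}; set m := (#|V| - 2 * t)%N.
have m0 : (0 < m)%N by rewrite /m; lia.
have -> : potential F S H = lam #|V| / #|V|%:R ^+ (#|F| + #|S|).
  have pF : pending F H = F.
    apply/setP => e; rewrite inE; apply: andb_idl => eF.
    by case/and3P: nF => _ /forall_inP/(_ e eF)/andP[].
  rewrite /potential pF unsat_start // cardsT /compatible pF unsat_start //.
  rewrite subsetT; case: forall_inP => [|[]]; first by rewrite mul1r.
  by move=> e _; exact: subsetT.
move=> h; have mS : 0 < m%:R ^+ #|S| :> R by rewrite exprn_gt0 // ltr0n.
have := ler_wpM2r (ltW mS) h; rewrite mulr_suml => {}h.
have -> : lam #|V| * (m%:R / #|V|%:R) ^+ #|S| / #|V|%:R ^+ #|F|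
    = lam #|V| / #|V|%:R ^+ (#|F| + #|S|) * m%:R ^+ #|S|.
  by rewrite expr_div_n exprD invfM; ring.
apply: le_trans h; under [leRHS]eq_bigr do rewrite -mulrA.
apply: le_sum_mu => G sG cG.
have um : #|unsat G| = m by rewrite /m -cG addnK.
case: (boolP (_ && _)) => [/andP[FG SG]|_]; last first.
  by rewrite mulr_ge0 ?potential_ge0 ?(ltW mS).
have pF : pending F G = set0 by apply/eqP; rewrite setD_eq0.
rewrite /potential /compatible SG pF; case: forall_inP => [_|[]]; last first.
  by move=> e; rewrite inE.
rewrite mul1r cards0 add0n um divfK ?gt_eqF //.
exact: lam_ge1.
Qed.

End GoodProcess.

(** * Prescribed matchings and the branching of walks *)

Section NewMatchings.
Local Open Scope set_scope.
Local Open Scope nat_scope.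
Variables (V : finType) (H : sgraph V) (d : nat).
Hypothesis Hreg : regular d H.
Implicit Types (G : sgraph V) (F : {set {set V}}) (S : {set V}) (x y p : V).

Lemma new_matching_inj F S x y z :
  new_matching H F S -> [set x; y] \in F -> [set x; z] \in F -> y = z.
Proof.
case/and3P=> /trivIsetP tF /forall_inP F2 _ xy xz.
have [/eqP xx|xney] := eqVneq x y.
  by have := F2 _ xy; rewrite cards2 xx.
have [E|ne] := eqVneq [set x; y] [set x; z].
  have : y \in [set x; z] by rewrite -E set22.
  by rewrite !inE eq_sym (negPf xney) => /eqP.
have := disjointFr (tF _ _ xy xz ne) (set21 x y).
by rewrite set21.
Qed.

Lemma new_matching_add G F S x y : stage_graph H d G -> new_matching H F S ->
  F \subset edges G -> S \subset unsat d G ->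
  adj G x y -> ~~ adj H x y -> [set x; y] \notin F ->
  new_matching H ([set x; y] |: F) S.
Proof.
move=> sG nF FG SG xy nxy xyF; case/and3P: (nF) => tF /forall_inP F2 dS.
have key z z' e : adj G z z' -> ~~ adj H z z' -> e \in F -> z \in e -> e = [set z; z'].
  move=> zz nzz eF ze; have /andP[/cards2P[a [b [ab E]]] eH] := F2 e eF.
  have eG := subsetP FG e eF.
  move: ze; rewrite E !inE => /orP[]/eqP ez; subst z.
    by rewrite (stage_new_inj Hreg sG zz nzz (z := b)) // /adj /= -E.
  by rewrite (stage_new_inj Hreg sG zz nzz (z := a)) 1?setUC // /adj /= setUC -E.
have xyd e : e \in F -> [disjoint [set x; y] & e].
  move=> eF; rewrite disjoints_subset; apply/subsetP => z; rewrite !inE.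
  case/orP=> /eqP->; apply: contra xyF => ze.
    by rewrite -(key _ _ _ xy nxy eF ze).
  rewrite adjC in xy; rewrite adjC in nxy.
  by rewrite setUC -(key _ _ _ xy nxy eF ze).
apply/and3P; split.
- apply: (trivIsetU1 _ tF _).1 => [e|]; first exact: xyd.
  by apply/negP => /F2; rewrite cards0.
- apply/forall_inP => e; rewrite in_setU1 => /orP[/eqP->|/F2//].
  by rewrite cards2 (adj_neq xy).
- rewrite disjoints_subset; apply/subsetP => z zS; rewrite inE; apply/negP.
  case/bigcupP=> e; rewrite in_setU1 => /orP[/eqP->|eF] ze; last first.
    by have := disjointFr dS zS; rewrite (_ : z \in cover F) //; apply/bigcupP; exists e.
  have zu := subsetP SG z zS; move: ze zu; rewrite !in_set2 => /orP[]/eqP->.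
    exact/negP/(stage_new_unsat Hreg sG xy nxy).
  by apply/negP/(stage_new_unsat Hreg sG (y := x)); rewrite adjC.
Qed.

Lemma new_matching_setU1 F S v : new_matching H F S -> v \notin cover F ->
  new_matching H F (v |: S).
Proof.
case/and3P=> tF F2 dS vF; rewrite /new_matching tF F2 disjoints_subset.
by rewrite subUset sub1set inE vF -disjoints_subset.
Qed.

(** This counts the continuations of a walk that came to [x] from [p], all possible fresh edges
    together being one branch. A fresh edge is possible only if [x] is neither in [S] nor covered by
    [F]; then [p] is an [H]-neighbour, and the fresh edge takes the place of the step back. If [x]
    is in [S], only the [d] edges of [H] are left. Otherwise [F] adds at most one neighbour, and the
    step back to [p] is excluded. *)
Lemma new_matching_branching F S p x : new_matching H F S ->
  [|| x \in S, adj H p x | [set p; x] \in F] ->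
  #|[set y | (adj H x y || ([set x; y] \in F)) && (y != p)]|
    + [exists y, new_matching H ([set x; y] |: F) S && ([set x; y] \notin F)]
  <= d.
Proof.
move=> nF inv; case/and3P: (nF) => tF /forall_inP F2 dS.
have cF y : [set x; y] \in F -> x \in cover F.
  by move=> xyF; apply/bigcupP; exists [set x; y] => //; exact: set21.
have xSF : x \in S -> x \notin cover F by move=> xS; rewrite (disjointFr dS xS).
have HF0 : x \notin cover F ->
    [set y | (adj H x y || ([set x; y] \in F)) && (y != p)] = [set y | adj H x y] :\ p.
  move=> xF; apply/setP => y; rewrite !inE andbC; congr andb.
  by apply: orb_idr => /cF; rewrite (negPf xF).
have cH : #|[set y | adj H x y]| = d by rewrite cardsE -(degree_start Hreg x).
case: existsP => [[y /andP[nF1 xyF]]|_].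
  case/and3P: (nF1) => tF1 _ dS1.
  have xF : x \notin cover F.
    apply/negP => /bigcupP[e eF xe]; move/trivIsetP: tF1.
    move/(_ [set x; y] e); rewrite !in_setU1 eqxx eF orbT => /(_ isT isT).
    have ne : [set x; y] != e by apply: contraNneq xyF => ->.
    by move/(_ ne)/(disjointFr)/(_ (set21 _ _)); rewrite xe.
  have xS : x \notin S.
    apply/negP => xS; have := disjointFr dS1 xS.
    by rewrite (_ : x \in cover _) //; apply/bigcupP; exists [set x; y]; rewrite ?setU11 ?set21.
  rewrite HF0 // addn1 -cH (cardsD1 p [set y | adj H x y]) inE.
  case/or3P: inv => [xS'|px|pxF]; first by rewrite xS' in xS.
    by rewrite adjC px.
  by case/negP: xF; apply: (cF p); rewrite setUC.
rewrite addn0; have [xS|xS] := boolP (x \in S).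
  by rewrite HF0 ?xSF // -cH subset_leq_card // subsetDl.
rewrite (negPf xS) /= in inv; pose HF := [set y | adj H x y] :|: [set y | [set x; y] \in F].
have pHF : p \in HF by rewrite !inE adjC setUC.
have -> : [set y | (adj H x y || ([set x; y] \in F)) && (y != p)] = HF :\ p.
  by apply/setP => y; rewrite !inE andbC.
have : #|HF| <= d.+1.
  rewrite -addn1 (leq_trans (leq_card_setU _ _).1) // cH leq_add2l.
  apply/card_le1_eqP => y z; rewrite !inE => xy xz.
  exact: (new_matching_inj nF xz xy).
by rewrite (cardsD1 p) pHF add1n ltnS.
Qed.

End NewMatchings.

(** * Counting walks between unsaturated vertices *)

Section Walks.
Local Open Scope set_scope.
Local Open Scope nat_scope.
Local Open Scope ring_scope.
Variables (R : realFieldType) (V : finType).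
Implicit Types (G : sgraph V) (F : {set {set V}}) (S : {set V}) (u v x y p : V).

(* Sum of h over the endpoints of the non-backtracking walks of length l that
   start at x, coming from p. *)
Fixpoint walks G l p x (h : V -> R) : R :=
  if l is l'.+1 then \sum_(y | adj G x y && (y != p)) walks G l' x y h else h x.

Lemma walks_ge0 G l p x h : (forall v, 0 <= h v) -> 0 <= walks G l p x h.
Proof. by move=> h0; elim: l p x => [|l IH] p x //=; exact: sumr_ge0. Qed.

Lemma walks_lin G l p x h :
  walks G l p x h = \sum_v walks G l p x (fun y => (y == v)%:R) * h v.
Proof.
elim: l p x => [|l IH] p x /=.
  rewrite (bigD1 x) //= eqxx mul1r big1 ?addr0 // => v /negPf.
  by rewrite eq_sym => ->; rewrite mul0r.
under eq_bigr do rewrite IH.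
by rewrite exchange_big /=; apply: eq_bigr => v _; rewrite mulr_suml.
Qed.

Lemma walks_path G p x s : path (adj G) x s -> uniq (x :: s) -> p \notin s ->
  1 <= walks G (size s) p x (fun y => (y == last x s)%:R).
Proof.
elim: s p x => [|y s IH] p x /=; first by rewrite eqxx.
move=> /andP[xy ys] /andP[xs us] ps.
rewrite (bigD1 y) /=; last by rewrite xy; apply: contraNneq ps => ->; rewrite mem_head.
have x1 : x \notin s by apply: contra xs => xs; rewrite inE xs orbT.
rewrite -[leLHS]addr0; apply: lerD; first by apply: IH => //; rewrite us.
by apply: sumr_ge0 => z _; apply: walks_ge0 => v; exact: ler0n.
Qed.

Variables (d g : nat).

(** A short walk to a close vertex can be shortened to a path, which does not backtrack and so is
    counted on the right. Taking [u] as its own predecessor excludes no first step, as there are no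
    loops. *)
Lemma walks_close G u h : (forall v, 0 <= h v) ->
  \sum_(v in close d g G u) h v <= \sum_(l < g.-1) walks G l u u h.
Proof.
move=> h0; under [leRHS]eq_bigr do rewrite walks_lin.
rewrite exchange_big /= [leRHS](bigID (mem (close d g G u))) /=.
rewrite -[leLHS]addr0; apply: lerD; last first.
  apply: sumr_ge0 => v _; apply: sumr_ge0 => l _; rewrite mulr_ge0 //.
  by apply: walks_ge0 => y; exact: ler0n.
apply: ler_sum => v; rewrite inE => /and3P[_ vu nf].
rewrite -mulr_suml ler_peMl //.
have [s [sP ls sl]] : exists s, [/\ path (adj G) u s, last u s = v & (size s < g.-1)%N].
  have [h1|h1] := boolP [exists l : 'I_g.-1, has_walk G u v l].
    by case/existsP: h1 => l /has_walkP[s [sP ls sl]]; exists s; rewrite sl.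
  case/negP: nf; apply/farP => s sP ls; rewrite leqNgt; apply: contra h1 => sl.
  by apply/existsP; exists (Ordinal sl); apply/has_walkP; exists s.
case: (shortenP sP) ls => s' s'P us' sub ls'.
have ss : (size s' < g.-1)%N.
  by apply: leq_ltn_trans sl; apply: uniq_leq_size sub; case/andP: us'.
rewrite (bigD1 (Ordinal ss)) //= -[leLHS]addr0; apply: lerD.
  by rewrite -ls'; apply: walks_path => //; case/andP: us'.
by apply: sumr_ge0 => l _; apply: walks_ge0 => y; exact: ler0n.
Qed.

(* The number of j-tuples of walks of length < g - 1 from u to distinct
   unsaturated vertices outside S. *)
Fixpoint tuples G u S j : R :=
  if j is j'.+1 then \sum_(l < g.-1) walks G l u u (fun v =>
      ((v \in unsat d G) && (v \notin S))%:R * tuples G u (v |: S) j')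
  else 1.

Lemma tuples_ge0 G u S j : 0 <= tuples G u S j.
Proof.
elim: j S => [|j IH] S //=; apply: sumr_ge0 => l _; apply: walks_ge0 => v.
by rewrite mulr_ge0.
Qed.

Lemma tuplesS_ge G u S j :
  \sum_(v in close d g G u :\: S) tuples G u (v |: S) j <= tuples G u S j.+1.
Proof.
apply: le_trans (walks_close _ _ _); last first.
  by move=> v; rewrite mulr_ge0 ?tuples_ge0.
rewrite [leRHS](big_setID S) /= -[leLHS]add0r; apply: lerD.
  by apply: sumr_ge0 => v _; rewrite mulr_ge0 ?tuples_ge0.
apply: ler_sum => v; rewrite !inE => /and3P[-> -> _].
by rewrite mul1r.
Qed.

(** The targets are chosen one after the other; subtracting [j] in advance gives a lower bound for
    the number of candidates that is valid at each of the [j] choices. *)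
Lemma tuples_ge G u S j :
  (#|close d g G u| - #|S| - j)%N%:R ^+ j <= tuples G u S j.
Proof.
elim: j S => [|j IH] S; first by rewrite expr0 /=.
apply: le_trans (tuplesS_ge _ _ _ _).
set b := #|_|; pose X := (b - #|S| - j.+1)%N%:R ^+ j : R.
apply: (@le_trans _ _ (\sum_(v in close d g G u :\: S) X)); last first.
  apply: ler_sum => v; rewrite inE => /andP[vS _].
  apply: le_trans (IH _); rewrite cardsU1 vS add1n /X -/b.
  by rewrite -!subnDA addSnnS.
rewrite sumr_const -[leRHS]mulr_natl exprS; apply: ler_wpM2r; first exact: exprn_ge0.
rewrite ler_nat cardsD -/b; apply: leq_trans (leq_subr _ _) _.
by apply: leq_sub2l; apply: subset_leq_card; exact: subsetIr.
Qed.

Lemma tuples1_ge G u : #|close d g G u|%:R <= tuples G u [set u] 1.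
Proof.
apply: le_trans (tuplesS_ge _ _ _ _); rewrite /= sumr_const.
rewrite (_ : _ :\: _ = close d g G u) //; apply/setP => v; rewrite !inE.
by case: eqVneq => //= ->; rewrite andbF.
Qed.

(** [w] stands for the law [mu t] and [w_ev] for [sum_mu_event]: [C] is the factor [lam #|V|], and
    [z] the fraction of unsaturated vertices. *)
Variables (H : sgraph V) (w : sgraph V -> R) (b q0 : nat) (C z : R).
Hypotheses (Hreg : regular d H) (w0 : forall G, 0 <= w G).
Hypothesis w_supp : forall G, w G != 0 -> stage_graph H d G.
Hypotheses (db : (d <= b)%N) (b2 : (1 < b)%N) (V0 : (0 < #|V|)%N).

Let ev F S G := (F \subset edges G) && (S \subset unsat d G).

Hypotheses (C0 : 0 <= C) (z0 : 0 <= z).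
Hypothesis w_ev : forall F S, new_matching H F S -> (2 * #|F| + #|S| <= q0)%N ->
  \sum_G w G * (ev F S G)%:R <= C * z ^+ #|S| / #|V|%:R ^+ #|F|.

Lemma le_sum_w (f f' : sgraph V -> R) :
  (forall G, stage_graph H d G -> f G <= f' G) ->
  \sum_G w G * f G <= \sum_G w G * f' G.
Proof.
move=> ff; apply: ler_sum => G _; have [->|/w_supp sG] := eqVneq (w G) 0.
  by rewrite !mul0r.
by apply: ler_wpM2l (ff _ sG).
Qed.

(** The walk is revealed edge by edge. It follows an edge of [H] or [F], or a fresh edge, which then
    joins [F]. A fresh edge has at most [#|V|] possible ends, each paid for by a factor [1 / #|V|],
    so together they weigh as one branch, and [new_matching_branching] leaves at most [d <= b]
    branches per step. [K] measures the contribution of the endpoint. *)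
Lemma walks_bound l p x F S (h : sgraph V -> V -> R) (K : R) :
  (forall G v, 0 <= h G v) -> 0 <= K ->
  new_matching H F S -> [|| x \in S, adj H p x | [set p; x] \in F] ->
  (forall F' x', new_matching H F' S -> (#|F'| <= #|F| + l)%N ->
     \sum_G w G * ((ev F' S G)%:R * h G x') <= K / #|V|%:R ^+ #|F'|) ->
  \sum_G w G * ((ev F S G)%:R * walks G l p x (h G))
    <= b%:R ^+ l * K / #|V|%:R ^+ #|F|.
Proof.
move=> h0 K0; elim: l p x F => [|l IH] p x F nF inv hyp.
  by rewrite expr0 mul1r; apply: hyp; rewrite // addn0.
pose HF := [set y | (adj H x y || ([set x; y] \in F)) && (y != p)].
pose NW := [set y | new_matching H ([set x; y] |: F) S && ([set x; y] \notin F)].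
pose B : R := b%:R ^+ l * K / #|V|%:R ^+ #|F|.
have n0 : 0 < #|V|%:R :> R by rewrite ltr0n.
have B0 : 0 <= B by rewrite divr_ge0 ?mulr_ge0 ?exprn_ge0.
have W0 G y : 0 <= walks G l x y (h G) by exact: walks_ge0.
have step : \sum_G w G * ((ev F S G)%:R * walks G l.+1 p x (h G)) <=
   \sum_(y in HF) \sum_G w G * ((ev F S G)%:R * walks G l x y (h G))
   + \sum_(y in NW) \sum_G w G * ((ev ([set x; y] |: F) S G)%:R * walks G l x y (h G)).
  rewrite [X in _ <= X + _]exchange_big [X in _ <= _ + X]exchange_big -big_split /=.
  under [leRHS]eq_bigr do rewrite -!mulr_sumr -mulrDr.
  apply: le_sum_w => G sG; case: (boolP (ev F S G)) => [/andP[FG SG]|_]; last first.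
    by rewrite !mul0r add0r; apply: sumr_ge0 => y _; rewrite mulr_ge0.
  rewrite !mul1r big_mkcond [X in _ <= X + _]big_mkcond [X in _ <= _ + X]big_mkcond /=.
  rewrite -big_split /=; apply: ler_sum => y _.
  have P1 : 0 <= if y \in HF then walks G l x y (h G) else 0 by case: ifP.
  have P2 : 0 <= if y \in NW then (ev ([set x; y] |: F) S G)%:R * walks G l x y (h G) else 0.
    by case: ifP => // _; rewrite mulr_ge0.
  case: ifP => [/andP[xy yp]|_]; last by rewrite addr_ge0.
  case: (boolP (y \in HF)) P1 => [_ _|yH _]; first by rewrite lerDl.
  have /norP[nH nF'] : ~~ (adj H x y || ([set x; y] \in F)).
    by apply: contra yH => yH; rewrite inE yH.
  have yN : y \in NW by rewrite inE nF' andbT; apply: (new_matching_add Hreg sG).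
  rewrite yN add0r; have -> : ev ([set x; y] |: F) S G.
    by rewrite /ev subUset sub1set FG SG !andbT; exact: xy.
  by rewrite mul1r.
apply: le_trans step _.
have b1 : \sum_(y in HF) \sum_G w G * ((ev F S G)%:R * walks G l x y (h G)) <= #|HF|%:R * B.
  rewrite mulr_natl -sumr_const; apply: ler_sum => y; rewrite inE => /andP[yH yp].
  apply: IH => //; first by case/orP: yH => ->; rewrite ?orbT.
  by move=> F' x' nF' cF'; apply: hyp => //; rewrite (leq_trans cF') // leq_add2l.
have b2' : \sum_(y in NW) \sum_G w G * ((ev ([set x; y] |: F) S G)%:R * walks G l x y (h G))
    <= (NW != set0)%:R * B.
  have [->|NW0] := eqVneq NW set0; first by rewrite big_set0 mul0r.
  apply: (@le_trans _ _ (\sum_(y in NW) B / #|V|%:R)).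
    apply: ler_sum => y; rewrite inE => /andP[nF1 xyF].
    apply: le_trans (IH x y _ nF1 _ _) _.
    - by rewrite setU11 !orbT.
    - move=> F' x' nF' cF'; apply: hyp => //.
      by move: cF'; rewrite cardsU1 xyF add1n addSnnS.
    by rewrite cardsU1 xyF add1n exprS invfM /B mulrA mulrAC.
  rewrite sumr_const mul1r -[leLHS]mulr_natl mulrA ler_pdivrMr // mulrC.
  by rewrite ler_wpM2l // ler_nat max_card.
apply: le_trans (lerD b1 b2') _; rewrite -mulrDl -natrD exprS -!mulrA.
rewrite [b%:R ^+ l * _]mulrA -/B ler_wpM2r // ler_nat; apply: leq_trans db.
have := new_matching_branching Hreg nF inv; rewrite -/HF.
congr (_ + _ <= _)%N; congr nat_of_bool; apply/existsP/set0Pn => -[y].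
  by move=> yN; exists y; rewrite inE.
by rewrite inE => yN; exists y.
Qed.

(** Induction on the number of walks: each endpoint joins [S] and contributes a factor [z], the
    walks leading to it a factor of at most [b ^ g]. The hypothesis on [q0] budgets [g] revealed
    edges and one endpoint per walk. *)
Lemma tuples_bound u j F S : u \in S -> new_matching H F S ->
  (2 * (#|F| + j * g) + (#|S| + j) <= q0)%N ->
  \sum_G w G * ((ev F S G)%:R * tuples G u S j)
    <= C * z ^+ (#|S| + j) * (b ^ g)%:R ^+ j / #|V|%:R ^+ #|F|.
Proof.
elim: j F S => [|j IH] F S uS nF cq.
  under eq_bigr do rewrite mulr1; rewrite expr0 mulr1 addn0.
  by apply: w_ev => //; move: cq; rewrite mul0n !addn0.
pose K : R := C * z ^+ (#|S| + j.+1) * (b ^ g)%:R ^+ j.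
have K0 : 0 <= K by rewrite !mulr_ge0 ?exprn_ge0.
have n0 : 0 < #|V|%:R :> R by rewrite ltr0n.
apply: (@le_trans _ _ (\sum_(l < g.-1) b%:R ^+ l * K / #|V|%:R ^+ #|F|)); last first.
  rewrite -!mulr_suml exprSr mulrA -/K [K * _]mulrC.
  rewrite ler_wpM2r ?invr_ge0 ?exprn_ge0 // ler_wpM2r //.
  under eq_bigr do rewrite -natrX; rewrite -natr_sum ler_nat.
  have geo N : (\sum_(l < N) b ^ l < b ^ N)%N.
    elim: N => [|N IHN]; first by rewrite big_ord0.
    rewrite big_ord_recr /= expnS; apply: leq_trans (leq_mul b2 (leqnn _)).
    by rewrite mul2n -addnn -addSn leq_add2r.
  by apply: leq_trans (ltnW (geo _)) _; rewrite leq_pexp2l ?leq_pred // ltnW.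
under eq_bigr do rewrite /= !mulr_sumr.
rewrite exchange_big /=; apply: ler_sum => l _.
apply: walks_bound => //.
- by move=> G v; rewrite mulr_ge0 ?tuples_ge0.
- by rewrite uS.
move=> F' x nF' cF'.
have [xS|xS] := boolP (x \in S).
  rewrite big1 ?divr_ge0 ?exprn_ge0 // => G _.
  by rewrite andbF !(mul0r, mulr0).
(* An endpoint on a revealed new edge is saturated and contributes nothing. *)
have [xF|xF] := boolP (x \in cover F').
  apply: (@le_trans _ _ (\sum_G w G * 0)); last first.
    by rewrite big1 ?divr_ge0 ?exprn_ge0 // => G _; rewrite mulr0.
  apply: le_sum_w => G sG.
  case: (boolP (ev F' S G)) => [/andP[FG _]|_]; last by rewrite mul0r.
  suff -> : x \in unsat d G = false by rewrite mul0r mulr0.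
  apply/negbTE; case/bigcupP: xF => e eF xe.
  case/and3P: nF' => _ /forall_inP/(_ e eF)/andP[/cards2P[a [c [ac E]]] eH] _.
  have eG := subsetP FG e eF.
  rewrite E in xe; case/set2P: xe => ->.
    by apply: (stage_new_unsat Hreg sG (y := c)); rewrite /adj /= -E.
  by apply: (stage_new_unsat Hreg sG (y := a)); rewrite /adj /= setUC -E.
have := IH F' (x |: S) _ (new_matching_setU1 nF' xF).
rewrite in_setU1 uS orbT cardsU1 xS add1n addSnnS -/K => /(_ isT) {}IH.
apply: le_trans (IH _); last first.
  apply: leq_trans cq; rewrite leq_add2r leq_mul2l mulSn addnA leq_add2r /=.
  rewrite (leq_trans cF') // leq_add2l ltnW //.
  exact: leq_trans (ltn_ord l) (leq_pred g).
rewrite le_eqVlt; apply/orP; left; apply/eqP; apply: eq_bigr => G _.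
congr (_ * _); rewrite mulrA -natrM mulnb; congr (_%:R * _).
by rewrite /ev subUset sub1set andbT -andbA [(S \subset _) && _]andbC.
Qed.

End Walks.

(** * One stage *)

Section Stage.
Local Open Scope set_scope.
Local Open Scope nat_scope.
Local Open Scope ring_scope.
Variables (R : realFieldType) (V : finType) (H : sgraph V) (d g b r M : nat).
Variables (eta theta : R) (lam : nat -> R).
Hypotheses (Hreg : regular d H) (g3 : (2 < g)%N).
Hypotheses (db : (d <= b)%N) (b2 : (1 < b)%N) (V0 : (0 < #|V|)%N) (r0 : (0 < r)%N).
Implicit Types (G : sgraph V) (u v x y : V).

Local Notation unsat := (unsat d).
Local Notation avail_pairs := (avail_pairs d g).
Local Notation close := (close d g).
Local Notation stage_graph := (stage_graph H d).
Local Notation mu := (mu H d g eta).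
Local Notation good := (good d g eta).
Local Notation n := #|V|.
Local Notation q0 := (2 * (r * g) + (1 + r))%N.
Local Notation D := ((b ^ g)%:R : R).

Definition separated G := [forall u in unsat G, close G u == set0].

Lemma separated_add G u v : stage_graph G -> (u, v) \in avail_pairs G ->
  separated G -> separated (add_edge G [set u; v]).
Proof.
move=> sG uvA /forall_inP sep; have [uv uW vW nuv] := avail_pairs_unsat g3 uvA.
have fars x y : x \in unsat G -> y \in unsat G -> y != x -> far g G x y.
  move=> xW yW yx; apply: contraT => nf; have := sep x xW.
  by move/eqP/setP/(_ y); rewrite in_set0 in_close yW yx nf.
apply/forall_inP => x; rewrite (unsat_add Hreg g3 uvA sG) in_setD in_set2 negb_or.
case/andP=> /andP[xu xv] xW; apply/eqP/setP => y.
rewrite in_set0 in_close (unsat_add Hreg g3 uvA sG) in_setD.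
apply/negbTE/negP => /and3P[/andP[_ yW] yx /negP]; apply.
by apply: far_add_edge => //; apply: fars; rewrite // eq_sym.
Qed.

(** [a] will be the probability of eventual saturation as a function of the current graph; [alpha]
    bounds it from below once the stage is complete. *)
Variables (a : sgraph V -> R) (alpha : R).
Hypotheses (a0 : forall G, 0 <= a G) (al01 : 0 <= alpha <= 1).
Hypothesis a_end : forall G, regular d.+1 G -> alpha <= a G.
Hypothesis a_super : forall G, stage_graph G -> unsat G != set0 ->
  \sum_(e in avail_pairs G) a (add_edge G [set e.1; e.2])
    <= #|avail_pairs G|%:R * a G.

(** Every available step from a separated graph leads to a separated graph, and such a step exists
    until all vertices are saturated; [a_super] carries [alpha] backwards along these steps. *)
Lemma separated_ge i G : stage_graph G -> separated G -> #|unsat G| = (2 * i)%N ->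
  alpha <= a G.
Proof.
elim: i G => [|i IH] G sG sep cG.
  apply/a_end/(stage_regular Hreg sG)/eqP.
  by rewrite -cards_eq0 cG.
have W0 : unsat G != set0 by rewrite -card_gt0 cG.
have A0 : 0 < #|avail_pairs G|%:R :> R.
  rewrite ltr0n; case/set0Pn: (W0) => x xW.
  have := card_avail_of g xW; rewrite (eqP (forall_inP sep x xW)) cards0 addn0 cG.
  have [->|] := posnP #|[set v | (x, v) \in avail_pairs G]|; first by rewrite mulnS.
  rewrite card_gt0 => /set0Pn[y]; rewrite inE => xy _.
  by rewrite card_gt0; apply/set0Pn; exists (x, y).
rewrite -(ler_pM2l A0); apply: le_trans (a_super sG W0).
rewrite mulr_natl -sumr_const; apply: ler_sum => -[x y] xy /=.
apply: IH; [exact: (stage_add g3 xy)|exact: separated_add|].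
by have := card_unsat_add Hreg g3 xy sG; rewrite cG mulnS => -[].
Qed.

Hypotheses (t01 : 0 < theta <= 1) (e0 : 0 < eta).
Hypothesis (cond1 : forall m, (M <= m)%N ->
  4 * q0%:R * (1 + eta * m%:R) + 2 * q0%:R ^+ 2 <= theta * m%:R).
Hypothesis (cond2 : (4 * q0 <= M)%N).
Hypothesis (cond3 : forall m, (M <= m)%N -> 2 * r.+1%:R <= eta * m%:R).
Hypothesis lam_ge1 : forall m, (0 < m)%N -> 1 <= lam m.
Hypothesis lam_ge0 : forall m, 0 <= lam m.
Hypothesis lamSS : forall m, lam m * (1 + theta / m.+2%:R) <= lam m.+2.

Lemma M_gt0 : (0 < M)%N.
Proof. by apply: leq_trans cond2; rewrite muln_gt0 /= addn_gt0 orbT. Qed.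

Lemma sum_mu_tuples t u j : (j <= r)%N -> (2 * t + M <= n)%N ->
  \sum_G mu t G * ((u \in unsat G)%:R * tuples R d g G u [set u] j)
    <= lam n * ((n - 2 * t)%N%:R / n%:R) ^+ j.+1 * D ^+ j.
Proof.
move=> jr tM.
have := @tuples_bound R V d g H (mu t) b q0 (lam n) ((n - 2 * t)%N%:R / n%:R) Hreg
  (mu_ge0 _ _ _ _ _) (fun G h => (mu_supp Hreg g3 h).1) db b2 V0 (lam_ge0 _) _ _
  u j set0 [set u].
rewrite cards0 expr0 divr1 cards1 add1n => tb.
apply: le_trans (tb _ _ _ _ _); last 5 first.
- by rewrite divr_ge0.
- move=> F S nF cF; exact: (sum_mu_event Hreg g3 t01 (ltW e0) cond1 cond2 lam_ge1 lam_ge0 lamSS nF cF M_gt0 tM).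
- exact: set11.
- apply/and3P; split.
  + by apply/trivIsetP => A; rewrite inE.
  + by apply/forall_inP => e; rewrite inE.
  + by rewrite /cover big_set0 disjoint_sym disjoints_subset sub0set.
- by rewrite add0n leq_add // leq_mul2l leq_mul2r jr !orbT.
by apply: ler_sum => G _; rewrite sub0set sub1set.
Qed.

(** Markov's inequality for the [r]-th moment and a union bound over [u]: a vertex that violates
    goodness starts at least [(eta * m / 2) ^+ r] tuples, because by [cond3] the [r.+1] excluded
    targets are at most half of [eta * m]. *)
Lemma sum_mu_not_good t : (2 * t + M <= n)%N ->
  \sum_G mu t G * (~~ good G)%:R <= lam n * n%:R * (2 * D / (eta * n%:R)) ^+ r.
Proof.
move=> tM; set m := (n - 2 * t)%N.
have Mm : (M <= m)%N by rewrite /m leq_subRL; [|apply: leq_trans tM; exact: leq_addr].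
have m0 : 0 < m%:R :> R by rewrite ltr0n (leq_trans M_gt0).
have n0 : 0 < n%:R :> R by rewrite ltr0n.
pose X := (eta * m%:R / 2) ^+ r.
have X0 : 0 < X by rewrite exprn_gt0 // divr_gt0 // mulr_gt0.
have bad G u : stage_graph G -> #|unsat G| = m ->
    ((u \in unsat G) && ~~ (#|close G u|%:R <= eta * #|unsat G|%:R))%:R
    <= X^-1 * ((u \in unsat G)%:R * tuples R d g G u [set u] r).
  move=> sG um; have T0 := tuples_ge0 R d g G u [set u] r.
  case: (boolP (u \in unsat G)) => [uW|_] /=; last by rewrite mul0r mulr0.
  rewrite mul1r um -ltNge; case: ltP => [cl|_]; last by rewrite mulr_ge0 // invr_ge0 ltW.
  rewrite mulrC ler_pdivlMr // mul1r; apply: le_trans (tuples_ge _ _ _ _ _ _ _).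
  rewrite cards1 -subnDA add1n; have c3 := cond3 Mm.
  have h : eta * m%:R / 2 <= (#|close G u| - r.+1)%N%:R :> R.
    rewrite [leRHS]natrB; first by lra.
    by rewrite -(ler_nat R); have : 0 <= r.+1%:R :> R by []; lra.
  by rewrite lerXn2r // ?nnegrE // divr_ge0 // mulr_ge0 // ltW.
have le1 : \sum_G mu t G * (~~ good G)%:R <=
    \sum_u X^-1 * \sum_G mu t G * ((u \in unsat G)%:R * tuples R d g G u [set u] r).
  under [leRHS]eq_bigr do rewrite mulr_sumr.
  rewrite exchange_big /=; under [leRHS]eq_bigr do
    (under eq_bigr do rewrite mulrCA; rewrite -mulr_sumr).
  apply: (le_sum_mu Hreg g3) => G sG cG.
  have um : #|unsat G| = m by rewrite /m -cG addnK.
  apply: le_trans (ler_sum _ (fun u _ => bad G u sG um)).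
  rewrite -natr_sum ler_nat; case: (boolP (good G)) => //.
  rewrite negb_forall_in => /exists_inP[u uW nu].
  by rewrite (bigD1 u) //= uW nu.
apply: le_trans le1 _.
apply: (@le_trans _ _ (\sum_(u : V) X^-1 * (lam n * (m%:R / n%:R) ^+ r.+1 * D ^+ r))).
  apply: ler_sum => u _; rewrite ler_wpM2l ?invr_ge0 ?(ltW X0) //.
  exact: sum_mu_tuples.
rewrite sumr_const -[leLHS]mulr_natl.
have -> : n%:R * (X^-1 * (lam n * (m%:R / n%:R) ^+ r.+1 * D ^+ r)) =
    lam n * m%:R * (2 * D / (eta * n%:R)) ^+ r.
  have -> : (2 * D / (eta * n%:R)) ^+ r = X^-1 * (m%:R / n%:R) ^+ r * D ^+ r.
    rewrite /X -exprVn -!exprMn; congr (_ ^+ _); field.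
    by rewrite !gt_eqF.
  by rewrite exprS; field; rewrite !gt_eqF.
rewrite ler_wpM2r ?exprn_ge0 ?divr_ge0 ?mulr_ge0 ?(ltW n0) ?(ltW e0) //.
by rewrite ler_wpM2l // ler_nat /m leq_subr.
Qed.

(** The first moment suffices: in a graph that is not separated, some unsaturated [u] starts at
    least one walk to a close vertex. *)
Lemma sum_mu_not_separated t : (2 * t + M <= n)%N ->
  \sum_G mu t G * (~~ separated G)%:R
    <= lam n * (n - 2 * t)%N%:R ^+ 2 * D / n%:R.
Proof.
move=> tM; set m := (n - 2 * t)%N.
have n0 : 0 < n%:R :> R by rewrite ltr0n.
have le1 : \sum_G mu t G * (~~ separated G)%:R <=
    \sum_u \sum_G mu t G * ((u \in unsat G)%:R * tuples R d g G u [set u] 1).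
  rewrite exchange_big /=; under [leRHS]eq_bigr do rewrite -mulr_sumr.
  apply: (le_sum_mu Hreg g3) => G sG cG.
  have P u : 0 <= (u \in unsat G)%:R * tuples R d g G u [set u] 1.
    by rewrite mulr_ge0 ?tuples_ge0.
  case: (boolP (separated G)) => [_|]; first by apply: sumr_ge0.
  rewrite negb_forall_in => /exists_inP[u uW nu].
  rewrite (bigD1 u) //= uW mul1r -[leLHS]addr0; apply: lerD; last exact: sumr_ge0.
  apply: le_trans (tuples1_ge _ _ _ _ _).
  by rewrite ler1n card_gt0.
apply: le_trans le1 _.
apply: (@le_trans _ _ (\sum_(u : V) (lam n * (m%:R / n%:R) ^+ 2 * D ^+ 1))).
  by apply: ler_sum => u _; exact: sum_mu_tuples.
rewrite sumr_const -[leLHS]mulr_natl expr1 le_eqVlt; apply/orP; left; apply/eqP.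
by field; rewrite gt_eqF.
Qed.

(** Mass is lost only in states that are not good: while at least [M] vertices are unsaturated, a
    good state has an available pair. *)
Lemma sum_mu_mass t : (2 * t + M <= n)%N ->
  1 - \sum_(s < t) \sum_G mu s G * (~~ good G)%:R <= \sum_G mu t G.
Proof.
have mu1 s : \sum_G mu s G = \sum_G mu s G * 1.
  by apply: eq_bigr => G _; rewrite mulr1.
elim: t => [|t IH] tM; first by rewrite big_ord0 subr0 mu1 sum_mu0.
have tM' : (2 * t + M <= n)%N by apply: leq_trans tM; rewrite leq_add2r leq_mul2l leqnSn.
have e1 : \sum_G mu t.+1 G * 1 = _ := sum_muS H d g eta t (fun=> 1).
rewrite mu1 e1 big_ord_recr /= opprD addrA lerBlDr; apply: le_trans (IH tM') _.
rewrite mu1 -big_split /=.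
under [leRHS]eq_bigr do rewrite -mulrDr.
apply: (le_sum_mu Hreg g3) => G sG cG.
case: (boolP (good G)) => [gG|_]; last by rewrite mul0r mul0r add0r.
rewrite sumr_const mul1r addr0 mulVf // pnatr_eq0 -lt0n.
have MG : (M <= #|unsat G|)%N.
  by rewrite -(leq_add2r (2 * t)) cG addnC.
have W0 : unsat G != set0 by rewrite -card_gt0 (leq_trans M_gt0).
case/set0Pn: W0 => x xW; have := forall_inP gG x xW; have := card_avail_of g xW.
have [->|] := posnP #|[set v | (x, v) \in avail_pairs G]|; last first.
  rewrite card_gt0 => /set0Pn[y]; rewrite inE => xy _ _.
  by rewrite card_gt0; apply/set0Pn; exists (x, y).
(* Without partners, [x] would be close to all other unsaturated vertices, against goodness and
   [cond1]. *)
move=> cl; rewrite leNgt => /negP[].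
have c1 := cond1 MG; move: (congr1 (fun i => i%:R : R) cl); rewrite add0n natrD => cl'.
have q1 : 1 <= q0%:R :> R by rewrite ler1n addn_gt0 orbT.
have em : 0 <= eta * #|unsat G|%:R by rewrite mulr_ge0 // ltW.
have : theta * #|unsat G|%:R <= #|unsat G|%:R by rewrite ler_piMl //; case/andP: t01.
have : 1 * (1 + eta * #|unsat G|%:R) <= q0%:R * (1 + eta * #|unsat G|%:R).
  by rewrite ler_wpM2r // addr_ge0.
have : 0 <= q0%:R ^+ 2 :> R by rewrite exprn_ge0.
move: c1 cl' q1 em; move: (q0%:R : R) => q; move: (#|unsat G|%:R : R) => U.
lra.
Qed.

(** The mean of [a] at time [t] is at most [a H], and on separated states [a] is at least [alpha].
    The subtracted terms bound the mass killed before time [t] and the mass that is not separated at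
    time [t]. *)
Lemma stage_bound t : ~~ odd n -> (2 * t + M <= n)%N ->
  alpha - (t%:R * (lam n * n%:R * (2 * D / (eta * n%:R)) ^+ r)
           + lam n * (n - 2 * t)%N%:R ^+ 2 * D / n%:R) <= a H.
Proof.
move=> no tM; case/andP: (al01) => al0 al1.
have sup : \sum_G mu t G * a G <= a H.
  apply: (sum_mu_super Hreg g3) => // s G st sG cG _; apply: a_super => //.
  have s2 : (2 * s < n)%N.
    apply: leq_trans tM; apply: ltn_addr.
    by rewrite ltn_mul2l.
  rewrite -card_gt0; move: s2; rewrite -cG -{1}[(2 * s)%N]add0n ltn_add2r.
  by [].
apply: le_trans sup.
have sepb : \sum_G mu t G * (alpha * (1 - (~~ separated G)%:R)) <= \sum_G mu t G * a G.
  apply: (le_sum_mu Hreg g3) => G sG cG.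
  case: (boolP (separated G)) => sep; last by rewrite subrr mulr0.
  rewrite subr0 mulr1; apply: (@separated_ge (#|unsat G|./2)) => //.
  (* The number of unsaturated vertices stays even, since [n] is even and each step saturates
     two. *)
  have := odd_double_half #|unsat G|; rewrite -mul2n.
  suff -> : odd #|unsat G| = false by rewrite add0n.
  by move: no; rewrite -cG oddD oddM /= addbF => /negbTE.
apply: le_trans sepb.
have -> : \sum_G mu t G * (alpha * (1 - (~~ separated G)%:R)) =
    alpha * (\sum_G mu t G - \sum_G mu t G * (~~ separated G)%:R).
  rewrite -sumrB mulr_sumr; apply: eq_bigr => G _; ring.
have h1 := sum_mu_mass tM; have h2 := sum_mu_not_separated tM.
have h3 : \sum_(s < t) \sum_G mu s G * (~~ good G)%:R <=
    t%:R * (lam n * n%:R * (2 * D / (eta * n%:R)) ^+ r).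
  rewrite mulr_natl -[X in _ *+ X]card_ord -sumr_const; apply: ler_sum => s _.
  apply: sum_mu_not_good; apply: leq_trans tM.
  by rewrite leq_add2r leq_mul2l ltnW ?orbT.
set B1 := t%:R * _ in h3 *; set B2 := lam n * _ * _ / _ in h2 *.
have le1 : alpha * (1 - (B1 + B2)) <= alpha * (\sum_G mu t G - \sum_G mu t G * (~~ separated G)%:R).
  by rewrite ler_wpM2l //; move: h1 h2 h3; move: (\sum_(s < t) _) => ?; lra.
apply: le_trans le1; rewrite mulrBr mulr1 lerD2l lerN2 ler_piMl //.
rewrite /B1 /B2 addr_ge0 // ?divr_ge0 ?mulr_ge0 ?exprn_ge0 ?divr_ge0 ?mulr_ge0 ?(ltW e0) //.
Qed.

End Stage.

(** * Choice of the parameters of a stage *)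

Section Numerics.
Local Open Scope set_scope.
Local Open Scope nat_scope.
Local Open Scope ring_scope.
Variable R : realType.

Lemma powR_ge1 (x t : R) : 1 <= x -> 0 <= t -> 1 <= x `^ t.
Proof. by move=> x1 t0; rewrite -(powRr0 x); exact: ler_powR. Qed.

(** This makes a power of [m] a valid choice of [lam]. With a factor 2 to spare, it combines
    [1 + t * y <= exp (t * y)] and [ln (1 - y) <= - y] for [y = 2 / m.+2]. *)
Lemma powR_natSS (t : R) m : 0 < t ->
  m%:R `^ t * (1 + t / m.+2%:R) <= m.+2%:R `^ t.
Proof.
move=> t0; have [->|m0] := posnP m.
  by rewrite powR0 ?gt_eqF // mul0r powR_ge0.
have M0 : 0 < m%:R :> R by rewrite ltr0n.
have M2 : 0 < m.+2%:R :> R by rewrite ltr0n.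
have h1 : 1 + t / m.+2%:R <= expR (t * (2 / m.+2%:R)).
  apply: le_trans (expR_ge1Dx _); rewrite lerD2l ler_pM2l //.
  by rewrite ler_peMl ?invr_ge0 ?ler1n.
have h2 : ln (m%:R / m.+2%:R) <= - (2 / m.+2%:R) :> R.
  have -> : m%:R / m.+2%:R = 1 + - (2 / m.+2%:R) :> R.
    have -> : m%:R = m.+2%:R - 2 :> R by rewrite -addn2 natrD addrK.
    by rewrite mulrBl divff ?gt_eqF.
  apply: le_ln1Dx; rewrite ltrN2 ltr_pdivrMr // mul1r ltr_nat.
  by rewrite !ltnS.
rewrite ln_div ?posrE // in h2.
rewrite /powR !gt_eqF // ; apply: le_trans (ler_wpM2l (expR_ge0 _) h1) _.
rewrite -expRD ler_expR -mulrDr ler_pM2l //.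
by move: h2; move: (ln m%:R) (ln m.+2%:R) (2 / _) => u v w; lra.
Qed.

(** [x] will be the power [theta / 2] of [n], and all errors are measured in powers of [x]. [r] is
    the order of the moment, and [Q * x] bounds the number of reserved vertices. *)
Variables (V : finType) (H : sgraph V) (d g b K : nat) (A theta x e : R).
Variables (a : sgraph V -> R) (alpha : R).
Local Notation n := #|V|.
Local Notation r := (2 * K + 2)%N.
Local Notation Q := (2 * r%:R * A + r.+1%:R).
Hypotheses (Hreg : regular d H) (g3 : (2 < g)%N).
Hypotheses (db : (d <= b)%N) (b2 : (1 < b)%N) (V0 : (0 < n)%N) (nev : ~~ odd n).
Hypotheses (a0 : forall G, 0 <= a G) (al01 : 0 <= alpha <= 1).
Hypothesis a_end : forall G, regular d.+1 G -> alpha <= a G.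
Hypothesis a_super : forall G, stage_graph H d G -> unsat d G != set0 ->
  \sum_(e in avail_pairs d g G) a (add_edge G [set e.1; e.2])
    <= #|avail_pairs d g G|%:R * a G.
Hypotheses (t01 : 0 < theta <= 1) (A0 : 0 <= A).
Hypotheses (nx : n%:R <= x ^+ (2 * K)) (Dx : (b ^ g)%:R * x ^+ 16 <= n%:R).
Hypotheses (gx : g%:R <= A * x) (lx : n%:R `^ theta <= x ^+ 2).
Hypotheses (Qx : 8 * Q + 4 * Q ^+ 2 <= theta * x) (ex : 5 <= e * x).

(** Take [eta = x ^- 2] and for [lam m] the power [theta] of [m], and stop with about [x ^+ 4]
    unsaturated vertices. The two failure terms of [stage_bound] are then at most [1 / x] and
    [4 / x], while [5 <= e * x]. *)
Lemma stage_near : alpha - e <= a H.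
Proof.
case/andP: (t01) => t0 t1.
have r2 : 3 <= r.+1%:R :> R by rewrite ler_nat addn2.
have rA : 0 <= 2 * r%:R * A by rewrite !mulr_ge0.
have Q3 : 3 <= Q by lra.
have x60 : 60 <= x.
  have Q9 : 3 * 3 <= Q * Q by rewrite ler_pM //; lra.
  have x0 : 0 < x.
    by rewrite -(pmulr_rgt0 _ t0); apply: lt_le_trans Qx; rewrite expr2; lra.
  have : theta * x <= x by rewrite ler_piMl // ltW.
  by move: Qx; rewrite expr2; lra.
have x0 : 0 < x by lra.
have x1 : 1 <= x by lra.
have xX i : 0 < x ^+ i by rewrite exprn_gt0.
have q0Q : (2 * (r * g) + (1 + r))%N%:R <= Q * x.
  rewrite natrD natrM [(r * g)%:R]natrM add1n [leRHS]mulrDl.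
  apply: lerD; last by rewrite ler_peMr.
  by rewrite -!mulrA ler_pM2l // ler_wpM2l.
set q0 := (2 * (r * g) + (1 + r))%N in q0Q.
pose M := (Num.trunc (x ^+ 4)).+1.
have /andP[M1 M2] := truncn_itv (ltW (xX 4%N)); rewrite -/M in M2.
have M3 : M%:R <= x ^+ 4 + 1 by rewrite -natr1 lerD2r.
have xm m : (M <= m)%N -> x ^+ 4 <= m%:R.
  by move=> Mm; apply: ltW; apply: lt_le_trans M2 _; rewrite ler_nat.
pose eta := x ^- 2.
have e0 : 0 < eta by rewrite invr_gt0.
have Qx8 : 8 * Q <= theta * x by apply: le_trans Qx; rewrite lerDl mulr_ge0 ?exprn_ge0 //; lra.
have cond1 m : (M <= m)%N ->
  4 * q0%:R * (1 + eta * m%:R) + 2 * q0%:R ^+ 2 <= theta * m%:R.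
  move=> /xm xm4; have m0 : 0 <= m%:R :> R by [].
  have em : 0 <= 1 + eta * m%:R by rewrite addr_ge0 // mulr_ge0 // ltW.
  apply: (@le_trans _ _ (4 * (Q * x) * (1 + eta * m%:R) + 2 * (Q * x) ^+ 2)).
    apply: lerD; first by rewrite ler_wpM2r // ler_wpM2l.
    rewrite ler_wpM2l // lerXn2r // nnegrE //; apply: le_trans q0Q; exact: ler0n.
  have i1 : 8 * Q * (x * eta * m%:R) <= theta * m%:R.
    have -> : theta * m%:R = theta * x * (x * eta * m%:R).
      by rewrite /eta; field; rewrite gt_eqF.
    by rewrite ler_wpM2r // !mulr_ge0 // ltW.
  have i2 : (8 * Q + 4 * Q ^+ 2) * x ^+ 2 <= theta * m%:R.
    apply: le_trans (ler_wpM2r (ltW (xX 2%N)) Qx) _; rewrite -mulrA -exprS ler_pM2l //.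
    by apply: le_trans xm4; rewrite [leRHS]exprS ler_peMl // ltW.
  have i3 : Q * x <= Q * x ^+ 2 by rewrite ler_wpM2l ?[leRHS]exprS ?ler_peMr ?expr1 //; lra.
  by move: i1 i2 i3; rewrite !expr2 => i1 i2 i3; lra.
have x4 : x <= x ^+ 4 by rewrite exprS ler_peMr ?exprn_ege1 // ltW.
have cond2 : (4 * q0 <= M)%N.
  rewrite -(ler_nat R) natrM; apply: le_trans (ltW M2).
  apply: (@le_trans _ _ (4 * (Q * x))); first by rewrite ler_wpM2l.
  have : theta * x <= x by rewrite ler_piMl // ltW.
  have x2 : x * x <= x ^+ 4 by rewrite -expr2 ler_eXn2l //; lra.
  move=> tx; have : 8 * Q * x <= x * x by rewrite ler_wpM2r //; lra.
  have := mulr_gt0 (_ : 0 < Q) x0; lra.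
have cond3 m : (M <= m)%N -> 2 * r.+1%:R <= eta * m%:R.
  move=> /xm xm4; rewrite /eta [leRHS]mulrC ler_pdivlMr //; apply: le_trans xm4.
  have -> : x ^+ 4 = x * x * x ^+ 2 by ring.
  rewrite ler_wpM2r // ?(ltW (xX 2%N)) //.
  have : x <= x * x by rewrite ler_peMl // ltW.
  have : theta * x <= x by rewrite ler_piMl // ltW.
  lra.
have n0 : 0 < n%:R :> R by rewrite ltr0n.
have D1 : 1 <= (b ^ g)%:R :> R by rewrite ler1n expn_gt0 ltnW.
have x16n : x ^+ 16 <= n%:R by apply: le_trans Dx; rewrite ler_peMl // ltW.
have Mn : (M <= n)%N.
  rewrite -(ler_nat R); apply: le_trans M3 _; apply: le_trans x16n.
  have -> : x ^+ 16 = x ^+ 12 * x ^+ 4 by rewrite -exprD.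
  have : 2 * x ^+ 4 <= x ^+ 12 * x ^+ 4.
    rewrite ler_pM2r //; apply: le_trans (_ : x <= _); first by lra.
    by rewrite exprS ler_peMr ?exprn_ege1 // ltW.
  by have := x4; lra.
(* The last time with at least [M] unsaturated vertices; then [M] or [M.+1] of them are left. *)
pose t := (n - M)./2.
have t2 : (2 * t <= n - M)%N.
  by rewrite mul2n -[leqRHS](odd_double_half (n - M)) leq_addl.
have tM : (2 * t + M <= n)%N by rewrite addnC -leq_subRL.
have lam0 m : 0 <= m%:R `^ theta by exact: powR_ge0.
have lam1 m : (0 < m)%N -> 1 <= m%:R `^ theta by move=> m0; rewrite powR_ge1 ?ler1n // ltW.
have r0 : (0 < r)%N by rewrite addn2.
have := @stage_bound R V H d g b r M eta theta (fun m => m%:R `^ theta) Hreg g3 db b2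
  V0 r0 a alpha a0 al01 a_end a_super t01 e0 cond1 cond2 cond3 lam1 lam0
  (fun m => powR_natSS m t0) t nev tM.
apply: le_trans; rewrite lerD2l lerN2.
have ix : 0 < x^-1 by rewrite invr_gt0.
(* Exponents of [x]: [2 * K] each from [t] and [n], 2 from the power [theta] of [n], and -2 from
   each of the [r = 2 * K + 2] factors, in total -2. *)
have E1 : t%:R * (n%:R `^ theta * n%:R * (2 * (b ^ g)%:R / (eta * n%:R)) ^+ r) <= x^-1.
  have y0 : 0 <= 2 * (b ^ g)%:R / (eta * n%:R) by rewrite divr_ge0 // mulr_ge0 // ltW.
  have yb : 2 * (b ^ g)%:R / (eta * n%:R) <= x ^- 2.
    rewrite ler_pdivrMr ?mulr_gt0 // /eta.
    have -> : x ^- 2 * (x ^- 2 * n%:R) = n%:R / x ^+ 4 by field; rewrite gt_eqF.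
    rewrite ler_pdivlMr //; apply: le_trans Dx.
    rewrite [2 * _]mulrC -mulrA ler_pM2l ?(lt_le_trans _ D1) //.
    have -> : x ^+ 16 = x ^+ 12 * x ^+ 4 by rewrite -exprD.
    rewrite ler_pM2r //; apply: le_trans (_ : x <= _); first by lra.
    by rewrite exprS ler_peMr ?exprn_ege1 // ltW.
  have tn : t%:R <= n%:R :> R.
    by rewrite ler_nat (leq_trans _ (leq_trans t2 (leq_subr _ _))) // leq_pmull.
  apply: (@le_trans _ _ (x ^+ (2 * K) * (x ^+ 2 * x ^+ (2 * K) * (x ^- 2) ^+ r))).
    rewrite ler_pM // ?mulr_ge0 ?exprn_ge0 ?(le_trans tn nx) //.
    rewrite ler_pM // ?mulr_ge0 ?exprn_ge0 //; first by rewrite ler_pM.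
    by rewrite lerXn2r // nnegrE // ltW.
  rewrite exprVn -exprM -!exprD mulrA -!exprD ler_pdivrMr //.
  have -> : (2 * r = (2 * K + (2 + 2 * K)).+2)%N.
    by rewrite mulnDr mul2n -addnn [in RHS]addnCA addnC.
  by rewrite exprS mulKf ?gt_eqF // exprS ler_peMl // ltW.
have mM : (n - 2 * t <= M.+1)%N.
  have := odd_double_half (n - M); rewrite -mul2n -/t => h.
  rewrite leq_subLR -{1}(subnK Mn) -{1}h addnS -addnA -[leqRHS]add1n leq_add2r.
  by case: (odd _).
(* Exponents of [x]: [2 + 8 - 16 = -6], the last one from [Dx]. *)
have E2 : n%:R `^ theta * (n - 2 * t)%N%:R ^+ 2 * (b ^ g)%:R / n%:R <= 4 * x^-1.
  have mx : (n - 2 * t)%N%:R <= 2 * x ^+ 4.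
    apply: le_trans (_ : M.+1%:R <= _); first by rewrite ler_nat.
    rewrite -natr1; have := x4; lra.
  apply: (@le_trans _ _ (x ^+ 2 * (2 * x ^+ 4) ^+ 2 * (x ^+ 16)^-1)).
    rewrite -[leLHS]mulrA; apply: ler_pM.
    - by rewrite mulr_ge0 // exprn_ge0.
    - by rewrite divr_ge0.
    - apply: ler_pM => //; first by rewrite exprn_ge0.
      by rewrite lerXn2r // nnegrE // mulr_ge0 // ltW.
    - by rewrite ler_pdivrMr // mulrC ler_pdivlMr.
  have -> : x ^+ 2 * (2 * x ^+ 4) ^+ 2 / x ^+ 16 = 4 * (x ^- 1 * x ^- 5).
    by field; rewrite gt_eqF.
  rewrite ler_pM2l // expr1 ler_piMr // ?(ltW ix) // invf_le1 //.
  exact: exprn_ege1.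
apply: le_trans (lerD E1 E2) _.
have : 5 * x^-1 <= e by rewrite ler_pdivrMr.
by lra.
Qed.

End Numerics.

(** * All stages *)

Section MinDegree.
Local Open Scope set_scope.
Local Open Scope nat_scope.
Variables (V : finType) (d g : nat).
Implicit Types (G : sgraph V) (u v : V).

Lemma min_degreeE G u :
  (forall v, d <= degree G v) -> degree G u = d -> min_degree G = d.
Proof.
move=> dG du; apply/eqP; rewrite /min_degree eqn_leq; apply/andP; split.
  have : u \in index_enum V by rewrite mem_index_enum.
  elim: (index_enum V) => // v s IH; rewrite big_cons inE geq_min.
  by case/orP=> [/eqP<-|/IH->]; rewrite ?du ?leqnn ?orbT.
apply: (big_ind (fun m => d <= m)) => //; last by move=> m1 m2; rewrite leq_min => -> ->.
by rewrite -du; exact: max_card.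
Qed.

Lemma min_degree_verticesE G u : (forall v, d <= degree G v) -> degree G u = d ->
  min_degree_vertices G = unsat d G.
Proof. by move=> dG du; apply/setP => v; rewrite !inE (min_degreeE dG du). Qed.

Lemma availableP G e : min_degree_vertices G = unsat d G ->
  reflect (exists2 x, x \in avail_pairs d g G & e = [set x.1; x.2])
          (e \in available g G).
Proof.
move=> WE; rewrite inE; apply: (iffP existsP) => [[u /existsP[v]]|[[u v]]].
  case/and5P=> uv /eqP-> uW vW f; exists (u, v) => //.
  by rewrite inE /= uv -WE uW vW.
rewrite inE /= => /and4P[uv uW vW f] ->; exists u; apply/existsP; exists v.
by rewrite uv eqxx WE uW vW; exact: f.
Qed.

Lemma sum_avail_pairs (R : pzRingType) (f : {set V} -> R) G :
  min_degree_vertices G = unsat d G ->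
  (\sum_(x in avail_pairs d g G) f [set x.1; x.2]
    = (\sum_(e in available g G) f e) *+ 2)%R.
Proof.
move=> WE; rewrite (partition_big (fun x => [set x.1; x.2]) (mem (available g G))) /=.
  rewrite -sumrMnl; apply: eq_bigr => e /(availableP _ WE)[[u v] uvA eE].
  have uv : u != v by move: uvA; rewrite inE => /and4P[].
  rewrite (eq_bigr (fun=> f e)); last by move=> x /andP[_ /eqP->].
  rewrite sumr_const; congr (_ *+ _)%R.
  rewrite -[RHS](@card2_ordered V e) ?eE ?cards2 ?uv //; apply: eq_card => -[a b].
  rewrite [RHS]inE; apply: andb_idl; rewrite /= set2_eqE //.
  by case/orP=> /andP[/eqP-> /eqP->] //; rewrite avail_pairsC.
by move=> x xA; apply/(availableP _ WE); exists x.
Qed.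

End MinDegree.

(** * Induction over the stages *)

Section AllStages.
Local Open Scope set_scope.
Local Open Scope nat_scope.
Local Open Scope ring_scope.
Variable R : realType.

(** Downward induction on the degree: at [k]-regular graphs [a] is at least 1, and [stage_near]
    loses at most [e] in each of the [k - d] stages. *)
Lemma harmonic_lower_bound (c e : R) (k : nat) : 0 < c < 1 -> (2 < k)%N ->
  0 < e -> k%:R * e <= 1 ->
  exists n0, forall n, (n0 <= n)%N -> ~~ odd n ->
  forall (V : finType), #|V| = n ->
  forall g, (2 < g)%N -> (k.-1 ^ g)%:R <= n%:R `^ c ->
  forall a : sgraph V -> R, (forall G, 0 <= a G) ->
  (forall G, regular k G -> 1 <= a G) ->
  (forall G, ~~ regular k G ->
     \sum_(e in available g G) a (add_edge G e) <= #|available g G|%:R * a G) ->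
  forall d H, (d <= k)%N -> regular d H -> 1 - (k - d)%:R * e <= a H.
Proof.
move=> /andP[c0 c1] k3 e0 ke.
(* With [x] the power [theta / 2] of [n], the bound [Dx] amounts to [c + 8 * theta = 1]. *)
pose theta := (1 - c) / 8.
have t0 : 0 < theta by rewrite /theta; lra.
have t1 : theta <= 1 by rewrite /theta; lra.
(* [K >= 1 / theta] makes [x ^+ (2 * K)] at least [n]. *)
pose K := (Num.trunc (theta^-1)).+1.
have Kt : theta^-1 <= K%:R.
  have ti : 0 <= theta^-1 by rewrite invr_ge0 ltW.
  by have /andP[_ /ltW] := truncn_itv ti.
(* From [2 ^ g <= n] and [ln 2 >= 1 / 2] follows [g <= 2 * ln n = 4 / theta * ln x], and
   [ln x <= x]. *)
pose A := 4 / theta.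
have A0 : 0 <= A by rewrite divr_ge0 // ltW.
pose r := (2 * K + 2)%N; pose Q := 2 * r%:R * A + r.+1%:R.
have Q0 : 0 <= Q by rewrite /Q addr_ge0 // mulr_ge0 // mulr_ge0.
pose X0 := (8 * Q + 4 * Q ^+ 2) / theta + 5 / e.
have X00 : 0 <= X0.
  by rewrite addr_ge0 // divr_ge0 ?(ltW t0) ?(ltW e0) // addr_ge0 // mulr_ge0 // exprn_ge0.
(* This threshold gives [X0 <= x], which yields both [Qx] and [ex]. *)
exists (Num.trunc (X0 `^ (2 / theta))).+1 => n n0n nev V Vn g g3 Dn a a0 a1 a_sup.
pose x := n%:R `^ (theta / 2) : R.
have np : (0 < n)%N by exact: leq_trans n0n.
have n1 : 1 <= n%:R :> R by rewrite ler1n.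
have n0 : 0 <= n%:R :> R by [].
have xX i : x ^+ i = n%:R `^ (theta / 2 * i%:R).
  by rewrite powRrM powR_mulrn // powR_ge0.
have X0x : X0 <= x.
  have h : X0 `^ (2 / theta) <= n%:R.
    have /andP[_ /ltW] := truncn_itv (powR_ge0 X0 (2 / theta)).
    by move/le_trans; apply; rewrite ler_nat.
  have := ge0_ler_powR (ltW (divr_gt0 t0 (ltr0n R 2))) (powR_ge0 _ _) n0 h.
  rewrite -powRrM; have -> : 2 / theta * (theta / 2) = 1 by field; rewrite gt_eqF.
  by rewrite powRr1.
have x1 : 1 <= x by rewrite powR_ge1 // divr_ge0 // ltW.
have x0 : 0 < x by exact: lt_le_trans x1.
have nx : n%:R <= x ^+ (2 * K).
  rewrite xX -[leLHS]powRr1 //; apply: ler_powR => //.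
  have -> : theta / 2 * (2 * K)%:R = theta * K%:R by rewrite natrM; field.
  by rewrite -ler_pdivrMl // mulr1.
have Dx : (k.-1 ^ g)%:R * x ^+ 16 <= n%:R.
  apply: le_trans (ler_wpM2r _ Dn) _; first by rewrite exprn_ge0 // ltW.
  rewrite xX -powRD; last by rewrite pnatr_eq0 -lt0n np implybT.
  have -> : c + theta / 2 * 16%:R = 1 by rewrite /theta; field.
  by rewrite powRr1.
have lx : n%:R `^ theta <= x ^+ 2.
  by rewrite xX (_ : theta / 2 * 2%:R = theta) //; field.
have b2 : (1 < k.-1)%N by rewrite -ltnS prednK // ltnW // ltnW.
have gx : g%:R <= A * x.
  have ln2 : 2^-1 <= ln 2 :> R.
    have := @le_ln1Dx R (- 2^-1); rewrite (_ : 1 + - 2^-1 = 2^-1 :> R); last by field.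
    by rewrite lnV ?posrE // lerN2; apply; lra.
  have : (2 ^ g)%:R <= n%:R :> R.
    apply: le_trans (_ : (k.-1 ^ g)%:R <= _); first by rewrite ler_nat leq_exp2r // ltnW // ltnW.
    apply: le_trans Dn _; rewrite -[leRHS]powRr1 //; apply: ler_powR => //; exact: ltW.
  rewrite -ler_ln ?posrE ?ltr0n ?expn_gt0 // natrX lnXn // => gl.
  have lnx : ln n%:R = 2 / theta * ln x :> R by rewrite ln_powR; field; rewrite gt_eqF.
  have := ln_sublinear x0 => /ltW xl.
  have : 2 / theta * ln x <= 2 / theta * x by rewrite ler_wpM2l // divr_ge0 // ltW.
  rewrite -lnx => nl; have g2 : 2^-1 * g%:R <= ln 2 *+ g :> R.
    by rewrite -[leRHS]mulr_natr ler_wpM2r.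
  have -> : A = 2 * (2 / theta) by rewrite /A; field; rewrite gt_eqF.
  by move: (le_trans g2 (le_trans gl nl)); rewrite -[_ * _ * x]mulrA; lra.
have Qx : 8 * Q + 4 * Q ^+ 2 <= theta * x.
  rewrite -ler_pdivrMl // mulrC; apply: le_trans X0x; rewrite lerDl divr_ge0 // ltW //.
have ex : 5 <= e * x.
  rewrite -ler_pdivrMl // mulrC; apply: le_trans X0x; rewrite lerDr divr_ge0 ?(ltW t0) //.
  by rewrite addr_ge0 // mulr_ge0 // exprn_ge0.
(* [j] counts the stages still to come. *)
have main j : forall H, (j <= k)%N -> regular (k - j) H -> 1 - j%:R * e <= a H.
  elim: j => [|j IH] H jk Hreg.
    by rewrite mul0r subr0; apply: a1; rewrite subn0 in Hreg.
  have jk' : (j <= k)%N by exact: ltnW.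
  have dS : (k - j.+1).+1 = (k - j)%N by rewrite subnSK.
  have al : 0 <= 1 - j%:R * e <= 1.
    apply/andP; split; last by rewrite lerBlDr lerDl mulr_ge0 // ltW.
    by rewrite subr_ge0; apply: le_trans ke; rewrite ler_pM2r // ler_nat.
  rewrite (_ : 1 - j.+1%:R * e = 1 - j%:R * e - e); last by rewrite -natr1; ring.
  have := @stage_near R V H (k - j.+1) g k.-1 K A theta x e a (1 - j%:R * e) Hreg g3.
  rewrite dS Vn; apply=> //.
  - by rewrite -ltnS dS prednK ?leq_subr // ltnW // ltnW.
  - by move=> G; exact: IH.
  - move=> G sG /set0Pn[u]; rewrite inE => /eqP du.
    have WE := min_degree_verticesE (fun v => stage_degree_ge Hreg v sG) du.
    have := a_sup G; rewrite (_ : regular k G = false); last first.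
      apply/negbTE/negP => /forallP/(_ u); rewrite du.
      by rewrite ltn_eqF // -ltnS dS ltnS leq_subr.
    move=> /(_ isT) h; rewrite (sum_avail_pairs g (fun e => a (add_edge G e)) WE).
    have := sum_avail_pairs g (fun=> 1 : R) WE; rewrite !sumr_const => ->.
    by rewrite mulrnAl lerMn2r.
  - by rewrite t0.
by move=> d H dk Hreg; apply: main; rewrite ?leq_subr // subKn.
Qed.

End AllStages.

From mathcomp Require Import all_classical all_reals all_analysis.

Import numFieldNormedType.Exports.

Local Open Scope classical_set_scope.
Local Open Scope ring_scope.

(** * The Markov chain and its hitting probabilities *)

Section HittingProbability.
Variables (R : realType) (V : finType) (g k : nat).
Implicit Types (G H : sgraph V).

(* The probability that the chain started at G is k-regular at time j. *)
Fixpoint hit j G : R :=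
  if j is j'.+1 then \sum_H step_prob R g k G H * hit j' H
  else (regular k G)%:R.

Lemma sum_step_prob (f : sgraph V -> R) G :
  ~~ regular k G -> available g G != finset.set0 ->
  \sum_H step_prob R g k G H * f H =
  #|available g G|%:R^-1 * \sum_(e in available g G) f (add_edge G e).
Proof.
move=> nG A0; under eq_bigr do rewrite /step_prob (negPf nG) (negPf A0) /=.
rewrite (partition_big (add_edge G) predT) //= mulr_sumr; apply: eq_bigr => H _.
rewrite (eq_bigr (fun=> f H)); last by move=> e /andP[_ /eqP->].
rewrite sumr_const -[f H *+ _]mulr_natl mulrA [X in _ = X * _]mulrC.
by congr (_%:R / _ * _); apply: eq_card => e; rewrite !inE.
Qed.

Lemma sum_step_prob_stuck (f : sgraph V -> R) G :
  regular k G || (available g G == finset.set0) ->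
  \sum_H step_prob R g k G H * f H = f G.
Proof.
move=> st; rewrite (bigD1 G) //= /step_prob st eqxx mul1r big1 ?addr0 // => H.
by move=> /negPf HG; rewrite HG mul0r.
Qed.

Lemma available_add_mean (f : sgraph V -> R) G : ~~ regular k G ->
  #|available g G|%:R * \sum_H step_prob R g k G H * f H
  = \sum_(e in available g G) f (add_edge G e).
Proof.
move=> nG; have [A0|A0] := eqVneq (available g G) finset.set0.
  by rewrite A0 cards0 mul0r finset.big_set0.
by rewrite sum_step_prob // mulrA divff ?mul1r // pnatr_eq0 cards_eq0.
Qed.

Lemma hit_bounds j G : 0 <= hit j G <= 1.
Proof.
elim: j G => [|j IH] G /=; first by case: (regular k G); rewrite ?ler01 ?lexx.
have [st|] := boolP (regular k G || (available g G == finset.set0)).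
  by rewrite sum_step_prob_stuck.
rewrite negb_or => /andP[nG A0]; rewrite sum_step_prob //.
have A1 : 0 < #|available g G|%:R :> R by rewrite ltr0n card_gt0.
rewrite mulr_ge0 ?invr_ge0 ?(ltW A1) //=; last first.
  by apply: sumr_ge0 => e _; case/andP: (IH (add_edge G e)).
rewrite ler_pdivrMl // mulr1 -sumr_const; apply: ler_sum => e _.
by case/andP: (IH (add_edge G e)).
Qed.

Lemma hit_regular j G : regular k G -> hit j G = 1.
Proof.
elim: j => [|j IH] /= rG; first by rewrite rG.
by rewrite sum_step_prob_stuck ?rG // IH.
Qed.

Lemma step_prob_ge0 G H : 0 <= step_prob R g k G H.
Proof. by rewrite /step_prob; case: ifP => // _; rewrite divr_ge0. Qed.

(** [k]-regular graphs are absorbing. *)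
Lemma hit_leS j G : hit j G <= hit j.+1 G.
Proof.
elim: j G => [|j IH] G.
  rewrite [hit 0 G]/=; case: (boolP (regular k G)) => [rG|_]; first by rewrite hit_regular.
  by case/andP: (hit_bounds 1 G).
by rewrite /=; apply: ler_sum => H _; rewrite ler_wpM2l ?step_prob_ge0 //; exact: IH.
Qed.

Lemma hit_nondecreasing G : {homo hit^~ G : i j / (i <= j)%N >-> i <= j}.
Proof. by apply/nondecreasing_seqP => j; exact: hit_leS. Qed.

(** The probability that the chain started at [G] ever becomes [k]-regular. *)
Definition hit_lim G : R := limn (hit^~ G).

Lemma is_cvg_hit G : cvgn (hit^~ G).
Proof.
apply: nondecreasing_is_cvgn; first exact: hit_nondecreasing.
by exists 1 => _ [j _ <-]; case/andP: (hit_bounds j G).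
Qed.

Lemma hit_le_lim j G : hit j G <= hit_lim G.
Proof. exact: (nondecreasing_cvgn_le (@hit_nondecreasing G) (@is_cvg_hit G)). Qed.

Lemma hit_lim_harmonic G : ~~ regular k G ->
  \sum_(e in available g G) hit_lim (add_edge G e) = #|available g G|%:R * hit_lim G.
Proof.
move=> nG.
have c1 : \sum_(e in available g G) hit j (add_edge G e) @[j --> \oo]
    --> \sum_(e in available g G) hit_lim (add_edge G e).
  elim: (index_enum _) => [|e s IH].
    by rewrite big_nil; under eq_fun do rewrite big_nil; exact: cvg_cst.
  rewrite big_cons; under eq_fun do rewrite big_cons.
  by case: ifP => // _; apply: cvgD IH; exact: is_cvg_hit.
have c2 : #|available g G|%:R * hit j.+1 G @[j --> \oo]
    --> #|available g G|%:R * hit_lim G.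
  apply: cvgMl_tmp; rewrite (cvg_shiftS (hit^~ G)); exact: is_cvg_hit.
rewrite -(cvg_lim (@Rhausdorff R) c1) -(cvg_lim (@Rhausdorff R) c2).
by congr (limn _); apply/funext => j; rewrite /= available_add_mean.
Qed.

(* For g <= 2 the pairs that are adjacent in G are available, and choosing one
   of them leaves G unchanged. *)
Lemma available_maxn G e : e \in available g G -> e \notin available (maxn g 3) G ->
  add_edge G e = G.
Proof.
rewrite !inE => /existsP[u /existsP[v /and5P[uv /eqP-> uW vW f]]] n3.
have nf : ~~ far (maxn g 3) G u v.
  apply: contra n3 => f3; apply/existsP; exists u; apply/existsP; exists v.
  by rewrite uv eqxx uW vW.
apply: add_edge_id; apply: contraNT nf => nadj; case: (leqP 3 g) => g3 //.
apply/farP => -[|x [|y p]] //=; first by move=> _ /eqP; rewrite (negPf uv).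
by rewrite andbT => ux vx; move: ux; rewrite vx (negPf nadj).
Qed.

Lemma available_maxn_sub G : available (maxn g 3) G \subset available g G.
Proof.
apply/fintype.subsetP => e; rewrite !inE => /existsP[u /existsP[v /and5P[uv ee uW vW f]]].
apply/existsP; exists u; apply/existsP; exists v; apply/and5P; split=> //.
move: f; case: (distance G u v) => //= l; apply: leq_trans.
by rewrite -!subn1 leq_sub2r // leq_maxl.
Qed.

(** This allows [g] to be replaced by a value of at least 3, for which available pairs are never
    adjacent: the discarded pairs leave [G] unchanged and so contribute equally to both sides of
    [hit_lim_harmonic]. *)
Lemma hit_lim_harmonic3 G : ~~ regular k G ->
  \sum_(e in available (maxn g 3) G) hit_lim (add_edge G e)
  <= #|available (maxn g 3) G|%:R * hit_lim G.
Proof.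
move=> nG; have := hit_lim_harmonic nG.
rewrite (finset.big_setID (available (maxn g 3) G)) /= (finset.setIidPr (available_maxn_sub G)).
rewrite [X in _ + X = _](eq_bigr (fun=> hit_lim G)); last first.
  by move=> e; rewrite finset.in_setD => /andP[n3 eA]; rewrite available_maxn.
rewrite sumr_const -(cardsID (available (maxn g 3) G) (available g G)).
rewrite (finset.setIidPr (available_maxn_sub G)) natrD mulrDl [X in _ = _ + X]mulr_natl.
by move/addIr ->.
Qed.

End HittingProbability.

(** * From the chain to realizations of the process *)

Section ProcessLaw.
Variables (R : realType) (V : finType) (g k : nat) (G0 : sgraph V).
Variables (d : measure_display) (Omega : measurableType d) (P : probability Omega R).
Variable X : nat -> Omega -> sgraph V.
Hypothesis XP : high_girth_process P g k G0 X.
Implicit Types (h : nat -> sgraph V) (A : set Omega).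

Lemma measurable_mem s (l : seq (sgraph V)) : measurable [set w | X s w \in l].
Proof.
elim: l => [|H l IH].
  by rewrite (_ : [set _ | _] = set0) //; apply/seteqP; split.
rewrite (_ : [set _ | _] = [set w | X s w = H] `|` [set w | X s w \in l]).
  by apply: measurableU => //; exact: (hgp_measurable XP).
apply/seteqP; split=> w /=; rewrite inE; first by case/orP=> [/eqP|]; [left|right].
by case=> [->|->]; rewrite ?eqxx ?orbT.
Qed.

Lemma measurable_state s (Q : pred (sgraph V)) : measurable [set w | Q (X s w)].
Proof.
rewrite (_ : [set _ | _] = [set w | X s w \in enum Q]); first exact: measurable_mem.
by apply/seteqP; split=> w /=; rewrite mem_enum.
Qed.

Lemma total_probability A s : measurable A ->
  P A = (\sum_(H : sgraph V) P (A `&` [set w | X s w = H]))%E.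
Proof.
move=> mA.
have part (l : seq (sgraph V)) : uniq l -> P (A `&` [set w | X s w \in l]) =
    (\sum_(H <- l) P (A `&` [set w | X s w = H]))%E.
  elim: l => [_|H l IH /= /andP[Hl ul]].
    rewrite big_nil (_ : _ `&` _ = set0) ?measure0 //.
    by apply/seteqP; split=> w // [].
  rewrite big_cons -IH //.
  rewrite (_ : A `&` [set w | X s w \in H :: l] =
    (A `&` [set w | X s w = H]) `|` (A `&` [set w | X s w \in l])).
    apply: measureU.
    - by apply: measurableI => //; exact: (hgp_measurable XP).
    - by apply: measurableI => //; exact: measurable_mem.
    - apply/seteqP; split=> w //= [[_ ->] [_]].
      by rewrite (negPf Hl).
  rewrite -setIUr; congr (A `&` _); apply/seteqP; split=> w /=; rewrite inE.
    by case/orP=> [/eqP|]; [left|right].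
  by case=> [->|->]; rewrite ?eqxx ?orbT.
have := part (index_enum (sgraph V)) (index_enum_uniq _) => <-.
congr (P _); apply/seteqP; split=> w; last by case.
by move=> Aw; split=> //=; rewrite mem_index_enum.
Qed.

Let agree h t := [set w | forall s, (s <= t)%N -> X s w = h s].

Lemma agreeS h t : agree h t.+1 = agree h t `&` [set w | X t.+1 w = h t.+1].
Proof.
apply/seteqP; split=> w.
  by move=> ag; split=> [s st|]; apply: ag => //; exact: leqW.
by move=> [ag e] s; rewrite leq_eqVlt => /predU1P[->//|]; exact: ag.
Qed.

Lemma measurable_agree h t : measurable (agree h t).
Proof.
elim: t => [|t IH].
  rewrite (_ : agree h 0 = [set w | X 0 w = h 0%N]); first exact: (hgp_measurable XP).
  apply/seteqP; split=> w; first by move=> /(_ 0%N isT).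
  by move=> e s; rewrite leqn0 => /eqP->.
by rewrite agreeS; apply: measurableI => //; exact: (hgp_measurable XP).
Qed.

(** The Markov property, by induction on [j]: split according to the state at time [t.+1] and extend
    the history [h] by it. *)
Lemma agree_regular j h t :
  P (agree h t `&` [set w | regular k (X (t + j) w)])
  = (P (agree h t) * (hit R g k j (h t))%:E)%E.
Proof.
elim: j h t => [|j IH] h t.
  rewrite addn0 /=; have E w : agree h t w -> X t w = h t by move=> /(_ t (leqnn t)).
  case: (boolP (regular k (h t))) => rh.
    rewrite mule1; congr (P _); apply/seteqP; split=> w; first by case.
    by move=> aw; split=> //=; rewrite E.
  rewrite mule0 (_ : _ `&` _ = set0) ?measure0 //; apply/seteqP; split=> w //.
  by move=> [aw] /=; rewrite E // (negPf rh).
have mA := measurableI _ _ (measurable_agree h t) (measurable_state (t + j.+1) (regular k)).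
rewrite (total_probability t.+1 mA).
pose h' H := fun s => if s == t.+1 then H else h s.
have hE H s : (s <= t)%N -> h' H s = h s.
  by move=> st; rewrite /h' ltn_eqF // ltnS.
have aE H : agree (h' H) t = agree h t.
  apply/seteqP; split=> w aw s st; first by rewrite aw // hE.
  by rewrite hE // aw.
have pf : P (agree h t) \is a fin_num by exact: fin_num_measure (measurable_agree h t).
have term H : P (agree h t `&` [set w | regular k (X (t + j.+1) w)]
      `&` [set w | X t.+1 w = H])
    = (P (agree h t) * (step_prob R g k (h t) H * hit R g k j H)%:E)%E.
  have -> : agree h t `&` [set w | regular k (X (t + j.+1) w)] `&` [set w | X t.+1 w = H]
     = agree (h' H) t.+1 `&` [set w | regular k (X (t.+1 + j) w)].
    by rewrite agreeS aE /h' eqxx setIAC addnS addSn.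
  rewrite IH {2}/h' eqxx.
  have := hgp_step XP t (h' H); rewrite -/(agree (h' H) t.+1) -/(agree (h' H) t) => ->.
  by rewrite aE hE // {1}/h' eqxx -muleA -EFinM.
under eq_bigr do rewrite term.
under eq_bigr do rewrite -(fineK pf) -EFinM.
by rewrite sumEFin -mulr_sumr EFinM (fineK pf).
Qed.

Lemma measurable_saturates : measurable (saturates k X).
Proof.
rewrite (_ : saturates k X = \bigcup_t [set w | regular k (X t w)]).
  by apply: bigcup_measurable => t _; exact: measurable_state.
by apply/seteqP; split=> w; [case=> t rt; exists t|case=> t _ rt; exists t].
Qed.

Lemma hit_le_saturates j : ((hit R g k j G0)%:E <= P (saturates k X))%E.
Proof.
have := agree_regular j (fun=> G0) 0.
have -> : agree (fun=> G0) 0 = [set w | X 0 w = G0].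
  apply/seteqP; split=> w; first by move=> /(_ 0%N isT).
  by move=> e s; rewrite leqn0 => /eqP->.
rewrite (hgp_init XP) mul1e => <-; apply: le_measure; rewrite ?inE.
- by apply: measurableI; [exact: (hgp_measurable XP)|exact: measurable_state].
- exact: measurable_saturates.
by move=> w [_ rw]; exists j.
Qed.

Lemma hit_lim_le_saturates : ((hit_lim R g k G0)%:E <= P (saturates k X))%E.
Proof.
have pf : P (saturates k X) \is a fin_num.
  exact: fin_num_measure measurable_saturates.
rewrite -(fineK pf) lee_fin; apply: limr_le; first exact: is_cvg_hit.
by apply: nearW => j; rewrite -lee_fin (fineK pf) hit_le_saturates.
Qed.

End ProcessLaw.

(** * Degrees in a Hamilton cycle *)

Section HamiltonCycle.
Variable V : finType.

(** The cycle thus has no loops, and successor and predecessor differ, so that degrees are 2;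
    rotating [s] brings [x] to the front. *)
Lemma next_next_neq (s : seq V) x : uniq s -> (2 < size s)%N -> x \in s ->
  next s x != x /\ next s (next s x) != x.
Proof.
move=> us ss xs; have [i s' E] := rot_to xs.
have us' : uniq (x :: s') by rewrite -E rot_uniq.
have : (2 < size (x :: s'))%N by rewrite -E size_rot.
have nE y : next s y = next (x :: s') y by rewrite -E next_rot.
rewrite !nE {nE E}; case: s' us' => [|y [|z s']] //=.
rewrite !inE !negb_or => /andP[/and3P[xy xz _] _] _.
rewrite eqxx (eq_sym y x) (negPf xy) eqxx !(eq_sym _ x); split=> //.
Qed.

Lemma hamilton_cycle_regular (G : sgraph V) : hamilton_cycle G -> regular 2 G.
Proof.
case=> s [us sV s3 GE]; apply/forallP => v.
have N x := next_next_neq us s3 (sV x).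
have nP u : adj G v u = (u == next s v) || (u == prev s v).
  rewrite /adj /= GE; apply/imsetP/orP => [[x _ /eqP]|].
    rewrite set2_eqE; last by rewrite eq_sym (N x).1.
    case/orP=> /andP[/eqP-> /eqP->]; first by left.
    by right; rewrite prev_next.
  case=> /eqP->; first by exists v.
  by exists (prev s v) => //; rewrite next_prev // finset.setUC.
rewrite /degree (eq_card (B := [set next s v; prev s v]%SET)); last first.
  by move=> u; rewrite !inE nP.
rewrite cards2 eqSS eqb1; apply/negP => /eqP E.
by have := (N v).2; rewrite E next_prev // eqxx.
Qed.

End HamiltonCycle.

(** * The girth bound as a power of n, and the limit *)

Lemma expn_le_powR (R : realType) (c : R) (b g n : nat) : (1 < b)%N -> (0 < n)%N ->
  g%:R <= c * (ln n%:R / ln b%:R) -> (b ^ g)%:R <= n%:R `^ c :> R.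
Proof.
move=> b1 n0 hg; have lb : 0 < ln b%:R :> R by rewrite ln_gt0 // ltr1n.
rewrite -ler_ln ?posrE ?ltr0n ?expn_gt0 ?(ltnW b1) ?powR_gt0 ?ltr0n //.
rewrite natrX lnXn ?ltr0n ?(ltnW b1) // ln_powR -[_ *+ g]mulr_natl -ler_pdivlMr //.
by rewrite -mulrA.
Qed.

Theorem theorem1p1 (R : realType) (c : R) (hc : 0 < c < 1)
  (k : nat) (hk : (3 <= k)%N)
  (g : nat -> nat)
  (hg : forall n : nat, ~~ odd n -> (3 <= n)%N ->
    (g n)%:R <= c * (ln n%:R / ln (k - 1)%:R))
  (V : nat -> finType) (hV : forall n : nat, #|V n| = n)
  (G : forall n : nat, sgraph (V n))
  (hG : forall n : nat, ~~ odd n -> (3 <= n)%N -> hamilton_cycle (G n))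
  (d : nat -> measure_display) (Omega : forall n : nat, measurableType (d n))
  (P : forall n : nat, probability (Omega n) R)
  (X : forall n : nat, nat -> Omega n -> sgraph (V n))
  (hX : forall n : nat, ~~ odd n -> (3 <= n)%N ->
    high_girth_process (P n) (g n) k (G n) (X n)) :
  P n (saturates k (X n)) @[n --> within [set n | ~~ odd n] \oo] --> 1%E.

Proof.
case/andP: (hc) => c0 c1; have k0 : (0 < k)%N by exact: leq_trans hk.
have kE : (k - 1 = k.-1)%N by rewrite subn1.
have b1 : (1 < k.-1)%N by rewrite -ltnS prednK.
have fin n : ~~ odd n -> (3 <= n)%N -> P n (saturates k (X n)) \is a fin_num.
  by move=> no n3; exact: fin_num_measure (measurable_saturates (hX n no n3)).
apply/fine_cvgP; split.
  by exists 3%N => // n /= n3 no; exact: fin.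
apply/cvgrPdist_le => e e0.
(* At most [k] stages lose [e'] each, hence at most [e] in total; the minimum with 1 ensures
   [k * e' <= 1]. *)
pose e' := Num.min e 1 / k%:R.
have kR : 0 < k%:R :> R by rewrite ltr0n.
have m0 : 0 < Num.min e 1 by rewrite lt_min e0 ltr01.
have e'0 : 0 < e' by rewrite divr_gt0.
have ke' : k%:R * e' = Num.min e 1 by rewrite mulrC divfK // gt_eqF.
have ke1 : k%:R * e' <= 1 by rewrite ke' ge_min lexx orbT.
have [n0 hn0] := harmonic_lower_bound hc hk e'0 ke1.
(* Values [g n < 3] are replaced by 3; from [n1] on, the cube of [k.-1] is at most the power [c] of
   [n]. *)
pose n1 := (Num.trunc ((k.-1 ^ 3)%:R `^ c^-1 : R)).+1.
exists (maxn 3 (maxn n0 n1)) => // n /=; rewrite !geq_max => /and3P[n3 nn0 nn1] no.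
have np : (0 < n)%N by exact: leq_trans n3.
have Dn : (k.-1 ^ maxn (g n) 3)%:R <= n%:R `^ c :> R.
  rewrite /maxn; case: ifP => _; last first.
    by apply: expn_le_powR => //; have := hg n no n3; rewrite kE.
  have h : (k.-1 ^ 3)%:R `^ c^-1 <= n%:R :> R.
    have /andP[_ /ltW] := truncn_itv (powR_ge0 ((k.-1 ^ 3)%:R : R) c^-1).
    by move/le_trans; apply; rewrite ler_nat.
  have := ge0_ler_powR (ltW c0) (powR_ge0 _ _) (ler0n R n) h.
  by rewrite -powRrM mulVf ?gt_eqF // powRr1.
have := hn0 n nn0 no (V n) (hV n) (maxn (g n) 3) (leq_maxr _ _) Dn
  (hit_lim R (g n) k) _ _ _ 2%N (G n) (ltnW hk) (hamilton_cycle_regular (hG n no n3)).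
move=> lb; have {}lb : 1 - (k - 2)%:R * e' <= hit_lim R (g n) k (G n).
  apply: lb.
  - by move=> H; apply: le_trans (hit_le_lim R (g n) k 0 H); case/andP: (hit_bounds R (g n) k 0 H).
  - by move=> H rH; rewrite -(hit_regular R (g n) 0 rH); exact: hit_le_lim.
  - by move=> H; exact: hit_lim_harmonic3.
have f := fin n no n3; have p1 := probability_le1 (P n) (measurable_saturates (hX n no n3)).
have := hit_lim_le_saturates (hX n no n3); rewrite -(fineK f) lee_fin => lp.
rewrite -(fineK f) lee_fin in p1.
rewrite ger0_norm ?subr_ge0 // lerBlDr -lerBlDl; apply: le_trans (le_trans lb lp).
rewrite lerD2l lerN2; apply: le_trans (_ : k%:R * e' <= _).
  by rewrite ler_pM2r // ler_nat leq_subr.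
by rewrite ke' ge_min lexx.
Qed.
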